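(* Let $\mathcal X,\mathcal Y$ be real separable Hilbert spaces with complexifications $\mathcal X_{\mathbb C},\mathcal Y_{\mathbb C}$, and let $(\psi_j)_{j\in\mathbb N}$ be a Riesz basis of $\mathcal X$ with constant $C_\psi\ge1$, i.e. $$\frac1{C_\psi^2}\|\boldsymbol x\|_{\ell^2(\mathbb N)}^2\le\Big\|\sum_{j\in\mathbb N}x_j\psi_j\Big\|_{\mathcal X}^2\le C_\psi^2\|\boldsymbol x\|_{\ell^2(\mathbb N)}^2\qquad\forall\boldsymbol x\in\ell^2(\mathbb N).$$ Let $\theta>0$ and $\mathcal S_\theta^{\mathcal X}=\{x+\mathrm i y: x,y\in\mathcal X,\ \|y\|_{\mathcal X}<\theta\}\subset\mathcal X_{\mathbb C}$. Suppose that $\mathcal G:\mathcal S_\theta^{\mathcal X}\to\mathcal Y_{\mathbb C}$ is holomorphic and that there are constants $C,\alpha>0$ and $\tau\in[0,2)$ such that for all $a,b\in\mathcal S_\theta^{\mathcal X}$ $$\|\mathcal G(a)\|_{\mathcal Y_{\mathbb C}}\le C\exp(\alpha\|a\|_{\mathcal X_{\mathbb C}}^\tau),\qquad \|\mathcal G(a)-\mathcal G(b)\|_{\mathcal Y_{\mathbb C}}\le C\exp\big(\alpha(\|a\|_{\mathcal X_{\mathbb C}}^\tau+\|b\|_{\mathcal X_{\mathbb C}}^\tau)\big)\|a-b\|_{\mathcal X_{\mathbb C}}.$$ Let $\boldsymbol b=(b_j)_{j\in\mathbb N}\in\ell^2(\mathbb N)$ be a sequence of positive reals. Then the function $$u(\boldsymbol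 y):=\mathcal G\Big(\sum_{j\in\mathbb N}y_jb_j\psi_j\Big)$$ is $(\boldsymbol b,\theta/C_\psi,2,\delta,\mathcal Y_{\mathbb C})$-holomorphic for some $\delta=\delta(\alpha,\boldsymbol b,C_\psi,C_\tau,\tau)$, where $C_\tau$ is a constant such that $(x+y)^{\tau/2}\le C_\tau(x^{\tau/2}+y^{\tau/2})$ for all $x,y\in\mathbb R_+$.
   Context: Notation. $\gamma_N=\bigotimes_{j=1}^N\mathcal N(0,1)$ on $\mathbb R^N$ and $\gamma=\bigotimes_{j\in\mathbb N}\mathcal N(0,1)$ on $\mathbb R^\infty=\prod_{j\in\mathbb N}\mathbb R$ are product standard Gaussian measures; $L^2_\gamma(\mathbb R^\infty,X)$ is the Bochner space with norm $\|v\|^2=\int_{\mathbb R^\infty}\|v(\boldsymbol y)\|_X^2\,\gamma(d\boldsymbol y)$. The complexification $\mathcal X_{\mathbb C}$ of a real Hilbert space $\mathcal X$ is the canonical Hilbert space complexification, with $\|x+\mathrm iy\|_{\mathcal X_{\mathbb C}}^2=\|x\|_{\mathcal X}^2+\|y\|_{\mathcal X}^2$. The function $u$ is defined for $\gamma$-a.e. $\boldsymbol y\in\mathbb R^\infty$, namely whenever $\sum_jb_j^2y_j^2<\infty$. Admissibility. For $\boldsymbol b\in(0,\infty)^\infty$ and $\xi>0$, a vector $\boldsymbol\varrho\in(0,\infty)^N$ is $(\boldsymbol b,\xi,2)$-admissible if $\sum_{j=1}^N b_j^2\varrho_j^2\le\xi^2$. Holomorphy. Let $X$ be a complex separable Hilbert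 space, $\boldsymbol b\in(0,\infty)^\infty$, $\xi>0$, $\delta>0$. For $\boldsymbol\varrho\in(0,\infty)^N$ let $\mathcal S^{\mathbb C}_{\boldsymbol\varrho}=\{\boldsymbol z\in\mathbb C^N:|\Im z_j|<\varrho_j\ \forall j\}$ and $\mathcal B(\boldsymbol\varrho)=\{\boldsymbol z\in\mathbb C^N:|z_j|<\varrho_j\ \forall j\}$. A function $u\in L^2_\gamma(\mathbb R^\infty,X)$ is called $(\boldsymbol b,\xi,2,\delta,X)$-holomorphic if: (1) for every $N\in\mathbb N$ there is $u_N:\mathbb R^N\to X$ which, for every $(\boldsymbol b,\xi,2)$-admissible $\boldsymbol\varrho\in(0,\infty)^N$, admits a holomorphic extension (again denoted $u_N$) $\mathcal S^{\mathbb C}_{\boldsymbol\varrho}\to X$; and for all $N<M$, $u_N(y_1,\dots,y_N)=u_M(y_1,\dots,y_N,0,\dots,0)$ for all $(y_j)_{j=1}^N\in\mathbb R^N$; (2) for every $N\in\mathbb N$ there is $\varphi_N:\mathbb R^N\to\mathbb R_+$ with $\|\varphi_N\|_{L^2_{\gamma_N}(\mathbb R^N)}\le\delta$ and $\sup_{\boldsymbol\varrho\in(0,\infty)^N\ (\boldsymbol b,\xi,2)\text{-admissible}}\ \sup_{\boldsymbol z\in\mathcal B(\boldsymbol\varrho)}\|u_N(\boldsymbol y+\boldsymbol z)\|_X\le\varphi_N(\boldsymbol y)$ for all $\boldsymbol y\in\mathbb R^N$; (3) with $\tilde u_N(\boldsymbol y)=u_N(y_1,\dots,y_N)$ for $\boldsymbol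 y\in\mathbb R^\infty$, $\lim_{N\to\infty}\|u-\tilde u_N\|_{L^2_\gamma(\mathbb R^\infty,X)}=0$.
   Formalization: The constant δ is allowed to depend also on C and θ, in addition to α, b, C_ψ, C_τ, τ; this is unavoidable, since constant G ≡ C·y₀ forces δ ≥ C and G(a) = exp(a₁) forces δ to grow with θ. *)

(* Defs.v *)
From HB Require Import structures.
From mathcomp Require Import all_boot all_order all_algebra.
From mathcomp Require Import complex.
From mathcomp Require Import all_classical all_reals all_analysis.
From mathcomp Require Import ring lra.

Set Implicit Arguments.
Unset Strict Implicit.
Unset Printing Implicit Defensive.

Import Order.TTheory GRing.Theory Num.Theory.
Import numFieldNormedType.Exports.

Local Open Scope classical_set_scope.
Local Open Scope ring_scope.
Local Open Scope complex_scope.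

HB.instance Definition _ (R : realType) := NormedModule.copy R[i] R[i]^o.

HB.mixin Record CompleteNormedModule_isHilbert (R : realType) V
    & CompleteNormedModule R V := {
  inner : V -> V -> R ;
  innerC : forall x y, inner x y = inner y x ;
  inner_linearl : forall a x y z, inner (a *: x + y) z = a * inner x z + inner y z ;
  inner_norm : forall x, `|x| ^+ 2 = inner x x
}.

#[short(type="hilbertType")]
HB.structure Definition Hilbert (R : realType) :=
  {V of CompleteNormedModule R V & CompleteNormedModule_isHilbert R V}.

HB.mixin Record CompleteNormedModule_isComplexHilbert (R : realType) V
    & CompleteNormedModule R[i] V := {
  cinner : V -> V -> R[i] ;
  cinnerC : forall x y, cinner x y = (cinner y x)^* ;
  cinner_linearl : forall a x y z,
    cinner (a *: x + y) z = a * cinner x z + cinner y z ;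
  cinner_norm : forall x, `|x| ^+ 2 = cinner x x
}.

#[short(type="complexHilbertType")]
HB.structure Definition ComplexHilbert (R : realType) :=
  {V of CompleteNormedModule R[i] V & CompleteNormedModule_isComplexHilbert R V}.

Definition separable_space (T : topologicalType) :=
  exists2 D : set T, countable D & dense D.

(* The norm of a complex normed space takes values in R[i]; [rnorm] is the same
   norm with values in R. *)
Definition rnorm (R : realType) (V : normedModType R[i]) (v : V) : R :=
  complex.Re `|v|.

Lemma rnormE (R : realType) (V : normedModType R[i]) (v : V) :
  (rnorm v)%:C = `|v|.
Proof. by rewrite /rnorm RRe_real// normr_real. Qed.

Section inner_theory.
Context {R : realType} {X : hilbertType R}.
Implicit Types x y z : X.

Lemma inner_linearr a x y z : inner z (a *: x + y) = a * inner z x + inner z y.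
Proof. by rewrite innerC inner_linearl !(innerC z). Qed.

Lemma inner0l z : inner (0 : X) z = 0.
Proof.
have := inner_linearl 1 0 0 z; rewrite scaler0 add0r mul1r => /eqP.
by rewrite -subr_eq subrr eq_sym => /eqP.
Qed.

Lemma innerDl x y z : inner (x + y) z = inner x z + inner y z.
Proof. by have := inner_linearl 1 x y z; rewrite scale1r mul1r. Qed.

Lemma innerZl a x z : inner (a *: x) z = a * inner x z.
Proof. by have := inner_linearl a x 0 z; rewrite addr0 inner0l addr0. Qed.

Lemma innerDr x y z : inner z (x + y) = inner z x + inner z y.
Proof. by rewrite innerC innerDl !(innerC z). Qed.

Lemma innerZr a x z : inner z (a *: x) = a * inner z x.
Proof. by rewrite innerC innerZl (innerC z). Qed.

End inner_theory.

(* The pair (x, y) stands for x + i y. *)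
Definition complexification (R : realType) (X : hilbertType R) : Type :=
  (X * X)%type.

Section complexification.
Context {R : realType} {X : hilbertType R}.
Local Notation XC := (complexification X).

HB.instance Definition _ := GRing.Zmodule.copy XC (X * X)%type.

Let cscale (c : R[i]) (z : XC) : XC :=
  (complex.Re c *: z.1 - complex.Im c *: z.2,
   complex.Im c *: z.1 + complex.Re c *: z.2).

Let cscaleA a b v : cscale a (cscale b v) = cscale (a * b) v.
Proof.
case: a b v => [a a'] [b b'] [x y]; rewrite /cscale/=; congr pair;
  rewrite scalerBr scalerDr !scalerA scalerBl scalerDl.
- by rewrite !opprD addrACA.
- by rewrite addrACA [in LHS]addrC [RHS]addrC; congr (_ + _); rewrite addrC.
Qed.

Let cscale1 : left_id 1 cscale.
Proof. by case=> x y; rewrite /cscale/= !scale1r !scale0r subr0 add0r. Qed.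

Let cscaleDr : right_distributive cscale +%R.
Proof.
move=> [a a'] [x y] [x' y']; congr pair => /=; rewrite !scalerDr.
- by rewrite opprD addrACA.
- by rewrite addrACA.
Qed.

Let cscaleDl v : {morph cscale^~ v : a b / a + b}.
Proof.
move=> [a a'] [b b']; case: v => x y; congr pair => /=; rewrite !scalerDl.
- by rewrite opprD addrACA.
- by rewrite addrACA.
Qed.

HB.instance Definition _ := GRing.Zmodule_isLmodule.Build R[i] XC
  cscaleA cscale1 cscaleDr cscaleDl.

Let cnorm (z : XC) : R[i] := (Num.sqrt (`|z.1| ^+ 2 + `|z.2| ^+ 2))%:C.

Let cnormD u v : cnorm (u + v) <= cnorm u + cnorm v.
Proof.
case: u v => [x y] [x' y']; rewrite /cnorm -rmorphD lecR/=.
have sq (a b : R) : 0 <= a ^+ 2 + b ^+ 2 by rewrite addr_ge0 ?sqr_ge0.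
have := ler_normD x x'; have := ler_normD y y'.
move: (normr_ge0 x) (normr_ge0 y) (normr_ge0 x') (normr_ge0 y').
move: (normr_ge0 (x + x')) (normr_ge0 (y + y')).
move: `|x + x'| `|y + y'| `|x| `|y| `|x'| `|y'| => p q a b c d.
move=> p0 q0 a0 b0 c0 d0 qle ple.
set A := Num.sqrt (a ^+ 2 + _); set B := Num.sqrt (c ^+ 2 + _).
have A0 : 0 <= A by exact: sqrtr_ge0.
have B0 : 0 <= B by exact: sqrtr_ge0.
have A2 : A ^+ 2 = a ^+ 2 + b ^+ 2 by rewrite sqr_sqrtr.
have B2 : B ^+ 2 = c ^+ 2 + d ^+ 2 by rewrite sqr_sqrtr.
have cs : a * c + b * d <= A * B.
  rewrite -ler_sqr ?nnegrE ?mulr_ge0 ?addr_ge0 ?mulr_ge0// exprMn A2 B2.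
  have := sqr_ge0 (a * d - b * c); rewrite -subr_ge0 => h.
  by rewrite -subr_ge0; move: h; congr (0 <= _); ring.
rewrite -ler_sqr ?nnegrE ?sqrtr_ge0 ?addr_ge0// sqr_sqrtr//.
have -> : (A + B) ^+ 2 = a ^+ 2 + b ^+ 2 + (c ^+ 2 + d ^+ 2) + A * B *+ 2.
  by rewrite -A2 -B2; ring.
have : p ^+ 2 <= (a + c) ^+ 2 by rewrite ler_sqr ?nnegrE ?addr_ge0.
have : q ^+ 2 <= (b + d) ^+ 2 by rewrite ler_sqr ?nnegrE ?addr_ge0.
move: cs; rewrite !sqrrD; lra.
Qed.

Let sqn_scale (a a' : R) (x y : X) :
  `|a *: x - a' *: y| ^+ 2 + `|a' *: x + a *: y| ^+ 2 =
  (a ^+ 2 + a' ^+ 2) * (`|x| ^+ 2 + `|y| ^+ 2).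
Proof.
rewrite !inner_norm -scaleNr !(innerDl, innerDr, innerZl, innerZr) (innerC y x).
ring.
Qed.

Let cnormZ (l : R[i]) (z : XC) : cnorm (l *: z) = `|l| * cnorm z.
Proof.
case: l z => a a' [x y].
by rewrite normc_def /cnorm -rmorphM/= sqn_scale sqrtrM ?addr_ge0 ?sqr_ge0.
Qed.

Let cnorm_eq0 (z : XC) : cnorm z = 0 -> z = 0.
Proof.
case: z => x y [/eqP]; rewrite sqrtr_eq0 => h.
have [hx hy] : `|x| ^+ 2 = 0 /\ `|y| ^+ 2 = 0.
  by move: (sqr_ge0 `|x|) (sqr_ge0 `|y|) h => /=; lra.
by congr pair; apply/eqP; rewrite -normr_eq0 -sqrf_eq0 ?hx ?hy.
Qed.

HB.instance Definition _ := Lmodule_isNormed.Build R[i] XC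
  cnormD cnormZ cnorm_eq0.

Lemma complexification_normE (z : XC) :
  `|z| = (Num.sqrt (`|z.1| ^+ 2 + `|z.2| ^+ 2))%:C.
Proof. by []. Qed.

Lemma complexification_ge_re (z : XC) : `|z.1|%:C <= `|z|.
Proof.
rewrite complexification_normE lecR -[leLHS]normr_id -sqrtr_sqr.
by rewrite ler_sqrt ?addr_ge0 ?sqr_ge0// lerDl sqr_ge0.
Qed.

Lemma complexification_ge_im (z : XC) : `|z.2|%:C <= `|z|.
Proof.
rewrite complexification_normE lecR -[leLHS]normr_id -sqrtr_sqr.
by rewrite ler_sqrt ?addr_ge0 ?sqr_ge0// lerDr sqr_ge0.
Qed.

Lemma complexification_le (z : XC) : `|z| <= (`|z.1| + `|z.2|)%:C.
Proof.
rewrite complexification_normE lecR -ler_sqr ?nnegrE ?sqrtr_ge0 ?addr_ge0//.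
rewrite sqr_sqrtr ?addr_ge0 ?sqr_ge0// sqrrD.
by rewrite -addrA lerD2l lerDr mulrn_wge0 ?mulr_ge0.
Qed.

Let cinn (u v : XC) : R[i] :=
  (inner u.1 v.1 + inner u.2 v.2) +i* (inner u.2 v.1 - inner u.1 v.2).

Let cinnC u v : cinn u v = (cinn v u)^*.
Proof.
by rewrite /cinn/= opprB !(innerC v.1) !(innerC v.2).
Qed.

Let cinn_linearl a x y z :
  cinn (a *: x + y) z = a * cinn x z + cinn y z.
Proof.
case: a x y z => [a a'] [x x'] [y y'] [z z']; rewrite /cinn/=.
rewrite -!scaleNr !(innerDl, innerZl).
by congr Complex; rewrite /=; ring.
Qed.

Let cinn_norm (z : XC) : `|z| ^+ 2 = cinn z z.
Proof.
rewrite complexification_normE -rmorphXn/= sqr_sqrtr ?addr_ge0 ?sqr_ge0//.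
by rewrite /cinn (innerC z.2) subrr !inner_norm.
Qed.

Let ccomplete (F : set_system XC) : ProperFilter F -> cauchy F -> cvg F.
Proof.
move=> FF /cauchyP Fc.
have c1 : cauchy ((fun z : XC => z.1) @ F).
  apply/cauchyP => e e0; have ec0 : 0 < e%:C by rewrite ltcR.
  have [x xF] := Fc _ ec0; exists x.1.
  suff: F [set z : XC | ball x.1 e z.1] by []; apply: filterS xF => z /=.
  rewrite -!ball_normE/= -ltcR => h; apply: le_lt_trans h.
  exact: (complexification_ge_re (x - z)).
have c2 : cauchy ((fun z : XC => z.2) @ F).
  apply/cauchyP => e e0; have ec0 : 0 < e%:C by rewrite ltcR.
  have [x xF] := Fc _ ec0; exists x.2.
  suff: F [set z : XC | ball x.2 e z.2] by []; apply: filterS xF => z /=.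
  rewrite -!ball_normE/= -ltcR => h; apply: le_lt_trans h.
  exact: (complexification_ge_im (x - z)).
have [l1 /cvgrPdist_lt h1] : exists l : X, (fun z : XC => z.1) @ F --> l.
  by exists (lim ((fun z : XC => z.1) @ F)); exact: cauchy_cvg.
have [l2 /cvgrPdist_lt h2] : exists l : X, (fun z : XC => z.2) @ F --> l.
  by exists (lim ((fun z : XC => z.2) @ F)); exact: cauchy_cvg.
apply: (@cvgP _ _ ((l1, l2) : XC)); apply/cvgrPdist_lt => e e0.
have [r r0 ->] : exists2 r : R, 0 < r & e = r%:C.
  by case: e e0 => r i; rewrite ltcE/= => /andP[/eqP-> ?]; exists r.
have r20 : 0 < r / 2 by rewrite divr_gt0.
near=> z.
apply: (le_lt_trans (complexification_le _)); rewrite ltcR (splitr r) ltrD//=.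
- by near: z; exact: h1.
- by near: z; exact: h2.
Unshelve. all: by end_near. Qed.

HB.instance Definition _ := Uniform_isComplete.Build XC ccomplete.

HB.instance Definition _ := CompleteNormedModule_isComplexHilbert.Build R XC
  cinnC cinn_linearl cinn_norm.

End complexification.

Definition of_real (R : realType) (X : hilbertType R) (x : X) :
  complexification X := (x, 0).

Definition strip (R : realType) (X : hilbertType R) (theta : R) :
  set (complexification X) := [set a : complexification X | `|a.2| < theta].

(* Frechet differentiability over the scalar field R[i]. *)
Definition holomorphic_on (R : realType) (V W : normedModType R[i]) (D : set V)
  (f : V -> W) : Prop := forall a, D a -> differentiable f a.

(* The product measurable space R^I, whose sigma-algebra is generated by the
   coordinates; a point of it is a function I -> R. *)
Definition coordinate_sets (R : realType) (I : Type) : set (set (I -> R)) :=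
  [set A | exists i (B : set R), measurable B /\ A = [set y | B (y i)]].

Notation product_space R I := (g_sigma_algebraType (@coordinate_sets R I)).

(* mu is the product over I of the measures N(0,1): this determines mu, as the
   sets below form a pi-system generating the sigma-algebra. *)
Definition standard_gaussian (R : realType) (I : eqType)
    (mu : probability (product_space R I) R) : Prop :=
  forall (s : seq I) (B : I -> set R), uniq s -> (forall i, measurable (B i)) ->
    mu [set y | forall i, i \in s -> B i (y i)] =
    (\prod_(i <- s) normal_prob 0 1 (B i))%E.

Section bochner.
Context {d : measure_display} {T : measurableType d} {R : realType}.
Context (mu : {measure set T -> \bar R}) {X : normedModType R[i]}.

(* Almost everywhere limit of simple functions (Bochner). *)
Definition strongly_measurable (f : T -> X) : Prop :=
  exists s : nat -> T -> X,
    (forall n, finite_set (range (s n)) /\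
               forall x, measurable (s n @^-1` [set x])) /\
    {ae mu, forall t, s n t @[n --> \oo] --> f t}.

Definition L2norm (f : T -> X) : \bar R :=
  ('N[mu]_2%:E[EFin \o (fun t => rnorm (f t))])%E.

Definition in_L2 (f : T -> X) : Prop :=
  strongly_measurable f /\ (L2norm f < +oo)%E.

End bochner.

Definition ell2 (R : realType) (x : nat -> R) : Prop :=
  cvgn (series (fun j => x j ^+ 2)).

Definition ell2_sqnorm (R : realType) (x : nat -> R) : R :=
  limn (series (fun j => x j ^+ 2)).

(* Only the two-sided bound is required, not that the span of psi is dense. *)
Definition riesz_basis (R : realType) (X : hilbertType R) (psi : nat -> X)
    (C : R) : Prop :=
  forall x : nat -> R, ell2 x ->
    let s := series (fun j => x j *: psi j) in
    [/\ cvgn s,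
        C ^- 2 * ell2_sqnorm x <= `|limn s| ^+ 2 &
        `|limn s| ^+ 2 <= C ^+ 2 * ell2_sqnorm x].

Section holomorphy.
Context {R : realType}.

Definition admissible (b : nat -> R) (xi : R) N (rho : 'I_N -> R) : Prop :=
  (forall j, 0 < rho j) /\ \sum_(j < N) b j ^+ 2 * rho j ^+ 2 <= xi ^+ 2.

Definition cstrip N (rho : 'I_N -> R) : set 'rV[R[i]]_N :=
  [set z : 'rV[R[i]]_N | forall j, `|complex.Im (z 0 j)| < rho j].

Definition cpolydisc N (rho : 'I_N -> R) : set 'rV[R[i]]_N :=
  [set z : 'rV[R[i]]_N | forall j, rnorm (z 0 j) < rho j].

Definition real_point N (y : 'I_N -> R) : 'rV[R[i]]_N := \row_j (y j)%:C.

Definition first_coords N (y : nat -> R) : 'I_N -> R := fun j => y j.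

Definition pad_zero N M (y : 'I_N -> R) : 'I_M -> R :=
  fun j => oapp y 0 (insub (val j)).

(* [uext N rho] is the holomorphic extension of [u_ N] to the strip of
   half-widths [rho]. *)
Definition gaussian_holomorphic
    (gammaN : forall N, probability (product_space R 'I_N) R)
    (gamma : probability (product_space R nat) R)
    (b : nat -> R) (xi delta : R) (X : complexHilbertType R)
    (u : (nat -> R) -> X) : Prop :=
  in_L2 gamma u /\
  exists (u_ : forall N, ('I_N -> R) -> X)
         (uext : forall N, ('I_N -> R) -> 'rV[R[i]]_N -> X),
  [/\ forall N (rho : 'I_N -> R), (0 < N)%N -> admissible b xi rho ->
        holomorphic_on (cstrip rho) (uext N rho) /\
        forall y, uext N rho (real_point y) = u_ N y,
      forall N M (y : 'I_N -> R), (0 < N < M)%N ->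
        u_ N y = u_ M (@pad_zero N M y),
      forall N, (0 < N)%N -> exists phi : product_space R 'I_N -> R,
        [/\ measurable_fun [set: product_space R 'I_N] phi,
            forall y, 0 <= phi y,
            ('N[gammaN N]_2%:E[EFin \o phi] <= delta%:E)%E &
            forall (rho : 'I_N -> R) (z : 'rV[R[i]]_N) (y : 'I_N -> R),
              admissible b xi rho -> cpolydisc rho z ->
              rnorm (uext N rho (real_point y + z)) <= phi y] &
      L2norm gamma (fun y => u y - u_ N (@first_coords N y)) @[N --> \oo] --> 0%E].

End holomorphy.

(* The function u(y) = G (sum_j y_j b_j psi_j), with value 0 on the gamma-null
   set of those y for which (b_j y_j)_j is not square summable. *)
Definition param_map (R : realType) (X Y : hilbertType R)
    (G : complexification X -> complexification Y) (b : nat -> R)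
    (psi : nat -> X) (y : nat -> R) : complexification Y :=
  if `[< ell2 (fun j => b j * y j) >]
  then G (of_real (limn (series (fun j => (y j * b j) *: psi j)))) else 0.

(* Main.v *)
(** As tau < 2, |x|^tau <= lam |x|^2 + K with lam as small as we please, so by
    the Riesz inequality every norm of G is bounded by an exponential of a
    small multiple of S(y) = sum_j b_j^2 y_j^2.  With B = sum_j b_j^2, Jensen's
    inequality for the weights b_j^2 / B gives
      exp(S(y) / (4 B)) <= 1 + sum_j (b_j^2 / B) exp(y_j^2 / 4),
    and the integral of the right-hand side only involves the one-dimensional
    marginals N(0,1): the independence of the coordinates is never used.  This
    yields the L^2 bounds, uniformly in N.  For the convergence, the Lipschitz
    bound on G gives, with t_N = sum_(j >= N) b_j^2,
      |u - u_N|^2 <= c exp(S / (8 B)) sum_(j >= N) b_j^2 y_j^2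
                  <= c sum_(j >= N) 32 b_j^2 exp(y_j^2 / 4)
                     + c t_N (1 + sum_j (b_j^2 / B) exp(y_j^2 / 4)),
    whose integral is O(t_N).  Such explicit majorants bound the integrals
    without any measurability of y |-> G(...). *)

Require Import Defs.
From mathcomp Require Import all_boot all_order all_algebra.
From mathcomp Require Import complex.
From mathcomp Require Import all_classical all_reals all_analysis.
From mathcomp Require Import measurable_realfun.
From mathcomp Require Import ring lra.

Set Implicit Arguments.
Unset Strict Implicit.
Unset Printing Implicit Defensive.

Import Order.TTheory GRing.Theory Num.Theory.
Import numFieldNormedType.Exports.

Local Open Scope classical_set_scope.
Local Open Scope ring_scope.

(** * Bounding integrals by pointwise majorants *)

Section integral_majorant.
Context d (T : measurableType d) (R : realType).
Variable mu : {measure set T -> \bar R}.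
Local Open Scope ereal_scope.

(** The integral of a nonnegative function is a supremum over the simple functions below it, and
    enlarging the function enlarges this family. *)
Lemma ge0_le_integral_nonmeasurable (f g : T -> \bar R) :
  (forall x, 0 <= f x) -> (forall x, f x <= g x) ->
  \int[mu]_x f x <= \int[mu]_x g x.
Proof.
move=> f0 fg; have g0 x : 0 <= g x by exact: le_trans (f0 x) (fg x).
rewrite !ge0_integralTE//; apply: ereal_sup_le => _ [h hf <-].
by exists h => // x; exact: le_trans (hf x) (fg x).
Qed.

(** Reduces every L^2 estimate below to an explicit majorant of the squared norm. The majorant [h]
    is extended-valued so that it may be a series that diverges at some points. *)
Lemma Lnorm2_le_sqrt (f : T -> R) (h : T -> \bar R) (K : R) :
  (forall x, ((f x) ^+ 2)%:E <= h x) -> \int[mu]_x h x <= K%:E ->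
  'N[mu]_2%:E[EFin \o f] <= (Num.sqrt K)%:E.
Proof.
move=> fh hK; have f2 x : `|(f x)%:E| `^ 2 = ((f x) ^+ 2)%:E.
  by rewrite abse_EFin poweR_EFin powR_mulrn// real_normK ?num_real.
have h0 x : 0 <= h x by apply: le_trans (fh x); rewrite lee_fin sqr_ge0.
have K0 : (0 <= K)%R.
  by rewrite -lee_fin; apply: le_trans hK; exact: integral_ge0.
have -> : (Num.sqrt K)%:E = K%:E `^ 2^-1 by rewrite poweR_EFin powR12_sqrt.
have fK : \int[mu]_x (`|(EFin \o f) x| `^ 2) <= K%:E.
  apply: le_trans hK; apply: ge0_le_integral_nonmeasurable => x.
    exact: poweR_ge0.
  by have := fh x; rewrite -f2.
rewrite unlock; apply: gt0_ler_poweR => //;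
  rewrite in_itv/= leey andbT ?lee_fin//.
by apply: integral_ge0 => x _; rewrite lee_fin powR_ge0.
Qed.

End integral_majorant.

(** * One-dimensional marginals of the Gaussian product measures *)

Section gaussian.
Context {R : realType}.

Lemma measurable_coordinate (I : Type) (i : I) :
  measurable_fun [set: product_space R I] (fun y : product_space R I => y i).
Proof.
move=> _ B mB; rewrite setTI; apply: sub_sigma_algebra.
by exists i, B.
Qed.

Lemma gaussian_marginal (I : eqType) (mu : probability (product_space R I) R)
    (i : I) (B : set R) :
  standard_gaussian mu -> measurable B ->
  mu [set y | B (y i)] = normal_prob 0 1 B.
Proof.
move=> muP mB; have /= := muP [:: i] (fun=> B) erefl (fun=> mB).
rewrite big_seq1 => <-; congr (mu _); apply/seteqP; split => y /= h.
- by move=> j; rewrite inE => /eqP ->.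
- by apply: h; rewrite inE.
Qed.

(** Change of variables: the image of [mu] under the i-th coordinate is N(0,1). *)
Lemma integral_coordinate (I : eqType) (mu : probability (product_space R I) R)
    (i : I) (g : R -> R) :
  standard_gaussian mu -> (forall x, 0 <= g x) -> measurable_fun setT g ->
  (\int[mu]_y (g (y i))%:E = \int[normal_prob 0 1]_x (g x)%:E)%E.
Proof.
move=> muP g0 mg.
have mc : measurable_fun setT
  (fun y : product_space R I => y i : measurableTypeR R).
  exact: measurable_coordinate.
have := ge0_integral_pushforward mc mu (f := EFin \o g) measurableT.
rewrite preimage_setT => <-//; last 2 first.
- exact/measurable_EFinP.
- by move=> x _; rewrite lee_fin.
apply: (eq_measure_integral (normal_prob 0 1)) => A mA _.
exact: gaussian_marginal.
Qed.

(** The integral is first written with the Radon-Nikodym derivative, which agrees almost everywhere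
    with [normal_pdf] because both have the same integral over every measurable set. *)
Lemma integral_normal_prob (m s : R) (g : R -> R) :
  (forall x, 0 <= g x) -> measurable_fun setT g ->
  (\int[normal_prob m s]_x (g x)%:E =
   \int[lebesgue_measure]_x (g x * normal_pdf m s x)%:E)%E.
Proof.
move=> g0 mg; have dom := normal_prob_dominates m s.
have mg' : measurable_fun setT (fun x : measurableTypeR R => (g x)%:E).
  exact/measurable_EFinP.
rewrite -(Radon_Nikodym_SigmaFinite.change_of_variables dom)//.
have mp : measurable_fun setT (fun x => (normal_pdf m s x)%:E).
  by apply/measurable_EFinP; exact: measurable_normal_pdf.
have fint := Radon_Nikodym_SigmaFinite.f_integrable dom.
under [RHS]eq_integral do rewrite EFinM.
apply: ae_eq_integral => //.
- by apply: emeasurable_funM => //; exact: measurable_int fint.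
- exact: emeasurable_funM.
apply: ae_eqe_mul2l; apply: integral_ae_eq => // E _ mE.
by rewrite -Radon_Nikodym_SigmaFinite.f_integral.
Qed.

(** Multiplying the N(0,1) density by exp(x^2/4) leaves exp(-x^2/4), that is, sqrt 2 times the
    density of the normal law with standard deviation sqrt 2. *)
Lemma integral_normal_expR_sqr4 :
  (\int[normal_prob 0 1]_x (expR (x ^+ 2 / 4))%:E = (Num.sqrt 2 : R)%:E)%E.
Proof.
rewrite integral_normal_prob; last 2 first.
- by move=> x; exact: expR_ge0.
- apply: measurableT_comp => //; apply: measurable_funM => //.
have s2 : Num.sqrt 2 != 0 :> R by rewrite sqrtr_eq0 -ltNge ltr0n.
have -> : (fun x : R => (expR (x ^+ 2 / 4) * normal_pdf 0 1 x)%:E) =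
    (fun x => ((Num.sqrt 2)%:E * (normal_pdf 0 (Num.sqrt 2) x)%:E)%E).
  apply/funext => x; rewrite -EFinM; congr EFin.
  rewrite !normal_pdfE ?oner_neq0// /normal_peak /normal_fun !subr0.
  rewrite expr1n sqr_sqrtr//.
  rewrite mul1r mulrCA -expRD mulrA; congr (_ * expR _).
    rewrite -(mulr_natl (2 * pi)) sqrtrM ?mulr_ge0 ?pi_ge0// invfM.
    by rewrite mulrA divff// mul1r mulr_natl.
  by rewrite mulr2n; field.
have mp : measurable_fun setT
    (fun x : measurableTypeR R => (normal_pdf 0 (Num.sqrt 2) x)%:E).
  by apply/measurable_EFinP; exact: measurable_normal_pdf.
rewrite ge0_integralZl//; last by move=> x _; rewrite lee_fin normal_pdf_ge0.
by rewrite integral_normal_pdf mule1.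
Qed.

End gaussian.

(** * Integrals of the exponential majorants *)

Section majorant.
Context {R : realType}.
Implicit Types (a s : R).

Lemma measurable_expR_sqr4 :
  measurable_fun setT (fun x : R => expR (x ^+ 2 / 4)).
Proof.
by apply: measurableT_comp => //; apply: measurable_funM => //;
  exact: measurable_funX.
Qed.

Lemma measurable_expR_coordinate (I : Type) (j : I) :
  measurable_fun [set: product_space R I]
    (fun y : product_space R I => expR (y j ^+ 2 / 4)).
Proof.
exact: (measurableT_comp measurable_expR_sqr4 (measurable_coordinate j)).
Qed.

Lemma integral_sum_expR_sqr4 (I : finType)
    (mu : probability (product_space R I) R)
    (c : I -> R) a :
  standard_gaussian mu -> (forall j, 0 <= c j) -> 0 <= a ->
  (\int[mu]_y (a + \sum_j c j * expR (y j ^+ 2 / 4))%:E =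
   (a + (\sum_j c j) * Num.sqrt 2)%:E)%E.
Proof.
move=> muP c0 a0.
have mc j : measurable_fun setT
    (fun y : product_space R I => (expR (y j ^+ 2 / 4))%:E).
  by apply/measurable_EFinP; exact: measurable_expR_coordinate.
have mc1 j : measurable_fun setT
    (fun y : product_space R I => (c j * expR (y j ^+ 2 / 4))%:E).
  apply/measurable_EFinP; apply: measurable_funM => //.
  exact: measurable_expR_coordinate.
under eq_integral do rewrite EFinD -sumEFin.
rewrite ge0_integralD//; last 2 first.
- by move=> y _; apply: sume_ge0 => j _; rewrite lee_fin mulr_ge0 ?expR_ge0.
- exact: emeasurable_sum.
rewrite integral_cst//= probability_setT mule1 ge0_integral_sum//; last first.
- by move=> j y _; rewrite lee_fin mulr_ge0 ?expR_ge0.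
rewrite EFinD; congr (_ + _)%E; rewrite mulr_suml -sumEFin.
apply: eq_bigr => j _.
under eq_integral do rewrite EFinM.
rewrite ge0_integralZl ?lee_fin//.
rewrite (integral_coordinate _ (g := fun x => expR (x ^+ 2 / 4)))//.
  by rewrite integral_normal_expR_sqr4 -EFinM.
exact: measurable_expR_sqr4.
Qed.

(** Monotone convergence exchanges integral and series; each coordinate then contributes the same
    factor sqrt 2. *)
Lemma integral_nneseries_expR_sqr4 (mu : probability (product_space R nat) R)
    (c : nat -> R) a s :
  standard_gaussian mu -> (forall j, 0 <= c j) -> 0 <= a ->
  (\sum_(j <oo) (c j)%:E <= s%:E)%E ->
  (\int[mu]_y (a%:E + \sum_(j <oo) (c j * expR (y j ^+ 2 / 4))%:E) <=
   (a + s * Num.sqrt 2)%:E)%E.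
Proof.
move=> muP c0 a0 cs.
have mc j : measurable_fun setT
    (fun y : product_space R nat => (expR (y j ^+ 2 / 4))%:E).
  by apply/measurable_EFinP; exact: measurable_expR_coordinate.
have c1 j (y : product_space R nat) : (0 <= (c j * expR (y j ^+ 2 / 4))%:E)%E.
  by rewrite lee_fin mulr_ge0 ?expR_ge0.
have mc1 j : measurable_fun setT
    (fun y : product_space R nat => (c j * expR (y j ^+ 2 / 4))%:E).
  apply/measurable_EFinP; apply: measurable_funM => //.
  exact: measurable_expR_coordinate.
rewrite ge0_integralD//; last 2 first.
- by move=> y _; apply: nneseries_ge0 => j _ _; exact: c1.
- exact: ge0_emeasurable_sum.
rewrite integral_cst//= probability_setT mule1 EFinD leeD2l//.
rewrite integral_nneseries//.
under eq_eseriesr => j _.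
  under eq_integral do rewrite EFinM.
  rewrite ge0_integralZl ?lee_fin//.
  rewrite (integral_coordinate _ (g := fun x => expR (x ^+ 2 / 4)))//;
    last exact: measurable_expR_sqr4.
  rewrite integral_normal_expR_sqr4 muleC.
  over.
rewrite nneseriesZl; last by move=> j _; rewrite lee_fin.
by rewrite EFinM muleC lee_wpmul2r// lee_fin sqrtr_ge0.
Qed.

End majorant.

(** * Elementary inequalities for exponentials and powers *)

Section elementary.
Context {R : realType}.

(** Jensen's inequality for weights of total mass W at most 1, the missing mass 1 - W being placed
    at the point 0. The proof sums the tangent inequality exp(t_i) >= exp(s) (1 + t_i - s), and the
    missing mass uses the same tangent at 0. *)
Lemma expR_sum_le (I : Type) (r : seq I) (P : pred I) (w t : I -> R) :
  (forall i, 0 <= w i) -> \sum_(i <- r | P i) w i <= 1 ->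
  expR (\sum_(i <- r | P i) w i * t i) <=
  1 + \sum_(i <- r | P i) w i * expR (t i).
Proof.
move=> w0; set W := \sum_(i <- r | P i) w i => W1.
set s := \sum_(i <- r | P i) w i * t i.
have W0 : 0 <= W by apply: sumr_ge0.
have tangent : expR s * (W + s - s * W) <= \sum_(i <- r | P i) w i * expR (t i).
  have -> : expR s * (W + s - s * W) =
      \sum_(i <- r | P i) w i * (expR s * (1 + (t i - s))).
    transitivity (\sum_(i <- r | P i)
        (expR s * w i + expR s * (w i * t i) - expR s * s * w i)).
      by rewrite sumrB big_split/= -!mulr_sumr -/W -/s; ring.
    by apply: eq_bigr => i _; ring.
  apply: ler_sum => i _; apply: ler_wpM2l => //.
  have -> : expR (t i) = expR s * expR (t i - s) by rewrite -expRD addrC subrK.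
  by rewrite ler_wpM2l ?expR_ge0// expR_ge1Dx.
have es : expR s * (1 - s) <= 1.
  have := expR_ge1Dx (- s); rewrite expRN => h.
  rewrite -(@ler_pM2l _ (expR s)^-1) ?invr_gt0 ?expR_gt0// mulKf ?mulr1//.
  by rewrite gt_eqF// expR_gt0.
have : (1 - W) * (expR s * (1 - s)) <= (1 - W) * 1.
  by rewrite ler_wpM2l// subr_ge0.
move: tangent; lra.
Qed.

(** The curves x^tau and lam x^2 cross at [x0]: beyond it the quadratic term dominates, and before
    it x^tau is at most the constant x0^tau. *)
Lemma powR_le_sqr (tau lam : R) : 0 <= tau -> tau < 2 -> 0 < lam ->
  exists2 K, 0 <= K & forall x, 0 <= x -> x `^ tau <= lam * x ^+ 2 + K.
Proof.
move=> tau0 tau2 lam0; pose x0 := lam^-1 `^ (2 - tau)^-1.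
have d0 : 0 < 2 - tau by rewrite subr_gt0.
have x00 : 0 < x0 by rewrite powR_gt0// invr_gt0.
exists (x0 `^ tau); first exact: powR_ge0.
move=> x xge0; have [xx0|x0x] := leP x x0.
  apply: (@le_trans _ _ (x0 `^ tau)).
    by apply: ge0_ler_powR => //; rewrite nnegrE// ltW.
  by rewrite lerDr mulr_ge0 ?sqr_ge0// ltW.
have xgt0 : 0 < x by exact: lt_trans x00 x0x.
apply: (@le_trans _ _ (lam * x ^+ 2)); last by rewrite lerDl powR_ge0.
have -> : x ^+ 2 = x `^ (2 - tau) * x `^ tau.
  rewrite -powR_mulrn// -powRD ?subrK//.
  by rewrite gt_eqF ?implybT.
rewrite mulrA ler_peMl ?powR_ge0//.
rewrite -ler_pdivrMl// mulr1.
have -> : lam^-1 = x0 `^ (2 - tau).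
  by rewrite /x0 -powRrM mulVf ?gt_eqF// powRr1// invr_ge0 ltW.
by apply: ge0_ler_powR; rewrite ?nnegrE ?ltW.
Qed.

(** Young's inequality gives y^2 E <= y^4/2 + E^2/2, and 1 + x <= exp(x) at x = y^2/8, once squared,
    gives y^4/64 <= exp(y^2/4); hence the factor 32. *)
Lemma sqr_mul_le_expR (y E : R) :
  y ^+ 2 * E <= 32 * expR (y ^+ 2 / 4) + E ^+ 2.
Proof.
have h : (y ^+ 2 / 8) ^+ 2 <= expR (y ^+ 2 / 4).
  have -> : expR (y ^+ 2 / 4) = expR (y ^+ 2 / 8) ^+ 2.
    by rewrite [RHS]expr2 -expRD; congr expR; field.
  have y0 : 0 <= y ^+ 2 / 8 by rewrite divr_ge0 ?sqr_ge0.
  rewrite ler_sqr ?nnegrE ?expR_ge0//.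
  by apply: le_trans (expR_ge1Dx _); rewrite lerDr.
have := sqr_ge0 (y ^+ 2 - E); have := sqr_ge0 E; rewrite sqrrB.
move: h; rewrite expr_div_n; lra.
Qed.

Lemma expR_mul_tail_le (b y : nat -> R) (B t : R) (N M : nat) : 0 < B ->
  \sum_(j < M) b j ^+ 2 <= B -> \sum_(j < M | (N <= j)%N) b j ^+ 2 <= t ->
  expR ((\sum_(j < M) b j ^+ 2 * y j ^+ 2) / (8 * B)) *
    \sum_(j < M | (N <= j)%N) b j ^+ 2 * y j ^+ 2 <=
  t + \sum_(j < M) (32 * (if (N <= j)%N then b j ^+ 2 else 0) +
                    t / B * b j ^+ 2) * expR (y j ^+ 2 / 4).
Proof.
move=> B0 bB bt; set E := expR _.
(* Squaring turns 8 B into 4 B, so the exponent becomes an average of the y_j^2/4 with weights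
   b_j^2/B, of total mass at most 1. *)
have E2 : E ^+ 2 <= 1 + \sum_(j < M) b j ^+ 2 / B * expR (y j ^+ 2 / 4).
  have -> : E ^+ 2 = expR (\sum_(j < M) b j ^+ 2 / B * (y j ^+ 2 / 4)).
    rewrite expr2 -expRD; congr expR.
    rewrite [RHS](eq_bigr (fun j : 'I_M => b j ^+ 2 * y j ^+ 2 * (4 * B)^-1)).
      by rewrite -mulr_suml; field; rewrite gt_eqF.
    by move=> j _; field; rewrite gt_eqF.
  apply: expR_sum_le => [j|]; first by rewrite divr_ge0 ?sqr_ge0 ?ltW.
  by rewrite -mulr_suml ler_pdivrMr// mul1r.
have t0 : 0 <= t by apply: le_trans bt; apply: sumr_ge0 => j _; exact: sqr_ge0.
have -> : t + \sum_(j < M) (32 * (if (N <= j)%N then b j ^+ 2 else 0) +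
    t / B * b j ^+ 2) * expR (y j ^+ 2 / 4) =
  \sum_(j < M | (N <= j)%N) b j ^+ 2 * (32 * expR (y j ^+ 2 / 4)) +
  t * (1 + \sum_(j < M) b j ^+ 2 / B * expR (y j ^+ 2 / 4)).
  rewrite [in RHS]big_mkcond/= mulrDr mulr1 addrCA mulr_sumr -big_split/=.
  congr (_ + _); apply: eq_bigr => j _; case: ifP => _; ring.
apply: (@le_trans _ _ (\sum_(j < M | (N <= j)%N)
    (b j ^+ 2 * (32 * expR (y j ^+ 2 / 4)) + b j ^+ 2 * E ^+ 2))).
  rewrite mulr_sumr; apply: ler_sum => j _; rewrite mulrCA -mulrDr.
  by rewrite ler_wpM2l ?sqr_ge0// mulrC sqr_mul_le_expR.
rewrite big_split/= lerD2l -mulr_suml.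
by rewrite ler_pM// ?sqr_ge0//; apply: sumr_ge0 => j _; exact: sqr_ge0.
Qed.

End elementary.

(** * Convergence in terms of the real-valued norm *)

Section rnorm_theory.
Context {R : realType} {V : normedModType R[i]}.
Implicit Types x y : V.

Lemma rnorm_ge0 x : 0 <= rnorm x.
Proof. by rewrite -lecR rnormE normr_ge0. Qed.

Lemma ler_rnormD x y : rnorm (x + y) <= rnorm x + rnorm y.
Proof. by rewrite -lecR rmorphD/= !rnormE ler_normD. Qed.

Lemma cvg_rnormP (T : Type) (F : set_system T) (FF : Filter F)
    (f : T -> V) (l : V) :
  f x @[x --> F] --> l <->
  forall e : R, 0 < e -> \forall t \near F, rnorm (l - f t) < e.
Proof.
split=> [/cvgrPdist_lt h e e0|h].
  have := h e%:C%C; rewrite ltcR => /(_ e0).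
  by apply: filterS => t; rewrite -rnormE ltcR.
apply/cvgrPdist_lt => e e0.
have [r r0 ->] : exists2 r : R, 0 < r & e = r%:C%C.
  by case: e e0 => r i; rewrite ltcE/= => /andP[/eqP-> ?]; exists r.
by apply: filterS (h _ r0) => t; rewrite -rnormE ltcR.
Qed.

Lemma cvg_rnorm_le (f : nat -> V) (l : V) (r : R) :
  f n @[n --> \oo] --> l -> (\forall n \near \oo, rnorm (f n) <= r) ->
  rnorm l <= r.
Proof.
move=> /cvg_rnormP fl fr; apply/ler_addgt0Pr => e e0.
have [n [h1 h2]] : exists n, rnorm (f n) <= r /\ rnorm (l - f n) < e.
  by apply: (@filter_ex _ (\oo : set_system nat)); near=> n; split;
    near: n => //; exact: fl.
by rewrite -[l](subrKC (f n)) (le_trans (ler_rnormD _ _))// lerD// ltW.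
Unshelve. all: by end_near. Qed.

End rnorm_theory.

(** * Complex combinations of real vectors *)

Section complexification_theory.
Context {R : realType} {X : hilbertType R}.
Implicit Types x y : X.

Lemma sqr_rnorm (z : complexification X) :
  rnorm z ^+ 2 = `|z.1| ^+ 2 + `|z.2| ^+ 2.
Proof.
by rewrite /rnorm complexification_normE/= sqr_sqrtr// addr_ge0// sqr_ge0.
Qed.

Lemma rnorm_of_real x : rnorm (of_real x) = `|x|.
Proof.
apply/eqP; rewrite -(@eqrXn2 _ 2) ?rnorm_ge0// sqr_rnorm/= normr0.
by rewrite expr0n addr0.
Qed.

Lemma of_realB x y : of_real (x - y) = of_real x - of_real y.
Proof. by congr pair; rewrite /= subr0. Qed.

Lemma cvg_of_real (T : Type) (F : set_system T) (FF : Filter F)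
    (f : T -> X) (l : X) :
  f x @[x --> F] --> l -> of_real (f x) @[x --> F] --> of_real l.
Proof.
move=> /cvgrPdist_lt fl; apply/cvg_rnormP => e e0.
by apply: filterS (fl _ e0) => t; rewrite -of_realB rnorm_of_real.
Qed.

(** The complex-linear extension of the real map sending y to the combination of the [v j]; composed
    with G it gives the holomorphic extension of u_N. *)
Definition complex_comb N (v : 'I_N -> X) (z : 'rV[R[i]]_N) :
    complexification X :=
  \sum_j z 0 j *: of_real (v j).

Lemma complex_comb1 N (v : 'I_N -> X) z :
  (complex_comb v z).1 = \sum_j complex.Re (z 0 j) *: v j.
Proof.
rewrite /complex_comb (big_morph (fun w : complexification X => w.1)
  (id1 := 0) (op1 := +%R))//.
by apply: eq_bigr => j _ /=; rewrite scaler0 subr0.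
Qed.

Lemma complex_comb2 N (v : 'I_N -> X) z :
  (complex_comb v z).2 = \sum_j complex.Im (z 0 j) *: v j.
Proof.
rewrite /complex_comb (big_morph (fun w : complexification X => w.2)
  (id1 := 0) (op1 := +%R))//.
by apply: eq_bigr => j _ /=; rewrite scaler0 addr0.
Qed.

Lemma complex_comb_real N (v : 'I_N -> X) (y : 'I_N -> R) :
  complex_comb v (real_point y) = of_real (\sum_j y j *: v j).
Proof.
rewrite [LHS](surjective_pairing (complex_comb v _ : X * X)).
rewrite complex_comb1 complex_comb2; congr pair.
  by apply: eq_bigr => j _; rewrite mxE.
by rewrite big1// => j _; rewrite mxE/= scale0r.
Qed.

Lemma differentiable_complex_comb N (v : 'I_N -> X) (z : 'rV[R[i]]_N) :
  differentiable (complex_comb v) z.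
Proof.
have -> : complex_comb v =
    \sum_(j < N) (fun w : 'rV[R[i]]_N => w 0 j *: of_real (v j)).
  by apply/funext => w; rewrite fct_sumE.
apply: differentiable_sum => j; apply: differentiableZl.
exact: differentiable_coord.
Qed.

End complexification_theory.

(** * Riesz inequality for finite sums and tails *)

Section riesz_partial_sums.
Context {R : realType} {X : hilbertType R}.

Lemma sum_vanishing_tail (V : nmodType) (g : nat -> V) (N n : nat) :
  (forall k, (N <= k)%N -> g k = 0) -> (N <= n)%N ->
  \sum_(0 <= k < n) g k = \sum_(k < N) g k.
Proof.
move=> g0 Nn; rewrite (big_cat_nat (n := N))//= big_mkord.
rewrite [X in _ + X = _](_ : _ = 0) ?addr0//.
by rewrite big_nat big1// => k /andP[/g0].
Qed.

Definition extend0 (V : nmodType) N (x : 'I_N -> V) : nat -> V :=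
  fun k => oapp x 0 (insub k).

Lemma extend0_ord (V : nmodType) N (x : 'I_N -> V) (i : 'I_N) :
  extend0 x i = x i.
Proof. by rewrite /extend0 valK. Qed.

Lemma extend0_out (V : nmodType) N (x : 'I_N -> V) k :
  (N <= k)%N -> extend0 x k = 0.
Proof. by move=> Nk; rewrite /extend0 insubF// ltnNge Nk. Qed.

(** Extension by zero yields an l^2 sequence; both series are constant from index N on, so their
    limits are the finite sums. *)
Lemma riesz_sum_le (psi : nat -> X) (C : R) N (x : 'I_N -> R) :
  riesz_basis psi C ->
  `|\sum_i x i *: psi i| ^+ 2 <= C ^+ 2 * \sum_i x i ^+ 2.
Proof.
move=> rp; pose x' := extend0 x.
have s2 n : (N <= n)%N -> series (fun j => x' j ^+ 2) n = \sum_i x i ^+ 2.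
  move=> Nn; rewrite /series/= (sum_vanishing_tail _ Nn) => [|k Nk].
    by apply: eq_bigr => i _; rewrite /x' extend0_ord.
  by rewrite /x' extend0_out// expr0n.
have s1 n : (N <= n)%N ->
    series (fun j => x' j *: psi j) n = \sum_i x i *: psi i.
  move=> Nn; rewrite /series/= (sum_vanishing_tail _ Nn) => [|k Nk].
    by apply: eq_bigr => i _; rewrite /x' extend0_ord.
  by rewrite /x' extend0_out// scale0r.
have c2 : series (fun j => x' j ^+ 2) @ \oo --> \sum_i x i ^+ 2.
  by apply: cvg_near_cst; exists N.
have c1 : series (fun j => x' j *: psi j) @ \oo --> \sum_i x i *: psi i.
  by apply: cvg_near_cst; exists N.
have [_ _] := rp x' (cvgP _ c2).
by rewrite /ell2_sqnorm (cvg_lim _ c2)// (cvg_lim _ c1).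
Qed.

(** The finite inequality for the coefficients set to zero below N. *)
Lemma riesz_tail_sum_le (psi : nat -> X) (C : R) N M (x : nat -> R) :
  riesz_basis psi C -> (N <= M)%N ->
  `|\sum_(j < M) x j *: psi j - \sum_(j < N) x j *: psi j| ^+ 2 <=
  C ^+ 2 * \sum_(j < M | (N <= j)%N) x j ^+ 2.
Proof.
move=> rp NM.
have := riesz_sum_le (fun j : 'I_M => if (N <= j)%N then x j else 0) rp.
congr (_ <= _).
  congr (`|_| ^+ 2); rewrite (big_ord_widen M (fun j => x j *: psi j) NM).
  rewrite [X in _ = _ - X]big_mkcond/= -sumrB; apply: eq_bigr => j _.
  by rewrite ltnNge; case: ifP => _; rewrite ?subr0// scale0r subrr.
rewrite [in RHS]big_mkcond/=; congr (_ * _); apply: eq_bigr => j _.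
by case: ifP => // _; rewrite expr0n.
Qed.

End riesz_partial_sums.

(** * Measurable functions with finitely many values *)

Section finitely_valued.
Context d (T : measurableType d).

(** Measurability is asked of the fibres, as in [strongly_measurable]. The codomain thus carries no
    sigma-algebra, and composition with an arbitrary map preserves the property. *)
Definition finitely_valued (Z : Type) (f : T -> Z) : Prop :=
  finite_set (range f) /\ forall z, measurable (f @^-1` [set z]).

Lemma finitely_valued_cst (Z : Type) (z : Z) : finitely_valued (fun=> z).
Proof.
split; first by apply: (sub_finite_set _ (finite_set1 z)) => _ [t _ <-].
move=> z'; have [->|zz'] := pselect (z = z').
  by rewrite (_ : _ @^-1` _ = setT)//; apply/seteqP; split.
by rewrite (_ : _ @^-1` _ = set0)//; apply/seteqP; split.
Qed.

Lemma finitely_valued_comp2 (Y Z W : Type) (op : Y -> Z -> W)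
    (f : T -> Y) (g : T -> Z) :
  finitely_valued f -> finitely_valued g ->
  finitely_valued (fun t => op (f t) (g t)).
Proof.
move=> [ff mf] [fg mg]; split.
  apply: (sub_finite_set _ (finite_image2 op ff fg)) => _ [t _ <-].
  by exists (f t); [exists t | exists (g t); [exists t|]].
move=> w.
(* Restricting to attained pairs of values makes the union of fibres finite. *)
pose P := [set p : Y * Z | [/\ range f p.1, range g p.2 & op p.1 p.2 = w]].
have -> : (fun t => op (f t) (g t)) @^-1` [set w] =
    \bigcup_(p in P) (f @^-1` [set p.1] `&` g @^-1` [set p.2]).
  apply/seteqP; split => t /=.
    by move=> tw; exists (f t, g t).
  by move=> [[y z] [/= _ _ <-] [/= -> ->]].
apply: fin_bigcup_measurable => [|p _]; last exact: measurableI.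
by apply: (sub_finite_set _ (finite_setX ff fg)) => p [].
Qed.

Lemma finitely_valued_comp (Y Z : Type) (h : Y -> Z) (f : T -> Y) :
  finitely_valued f -> finitely_valued (h \o f).
Proof.
move=> sf.
exact: (finitely_valued_comp2 (fun y _ => h y) sf (finitely_valued_cst tt)).
Qed.

Lemma finitely_valued_sum (V : nmodType) (n : nat) (f : nat -> T -> V) :
  (forall j, finitely_valued (f j)) ->
  finitely_valued (fun t => \sum_(j < n) f j t).
Proof.
move=> sf; elim: n => [|n ih].
  by under eq_fun do rewrite big_ord0; exact: finitely_valued_cst.
under eq_fun do rewrite big_ord_recr/=.
exact: finitely_valued_comp2.
Qed.

End finitely_valued.

Lemma finitely_valued_coordinate (R : realType) (Z : Type) (h : R -> Z)
    (j : nat) :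
  finitely_valued h ->
  finitely_valued (fun y : product_space R nat => h (y j)).
Proof.
move=> [fh mh]; split.
  by apply: (sub_finite_set _ fh) => _ [y _ <-]; exists (y j).
move=> z.
have := measurable_coordinate j (@measurableT _ (product_space R nat)) (mh z).
by rewrite setTI.
Qed.

(** * Approximating the identity of the real line by simple functions *)

Section simple_approximation.
Import HBNNSimple.

Lemma nnsfun_ge0_approx (R : realType) (f : R -> R) :
  measurable_fun setT f -> (forall x, 0 <= f x) ->
  exists g : nat -> R -> R, [/\ forall n, finitely_valued (g n),
    forall n x, 0 <= g n x <= f x & forall x, g n x @[n --> \oo] --> f x].
Proof.
move=> mf f0.
have mf' : measurable_fun setT (fun x : measurableTypeR R => (f x)%:E).
  exact/measurable_EFinP.
pose g := nnsfun_approx measurableT mf'.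
have gf x : (fun n => g n x) @ \oo --> f x.
  have := @cvg_nnsfun_approx _ _ _ _ measurableT _ mf' _ x I.
  by move=> h; apply: (fine_cvg (h _)) => y _; rewrite lee_fin.
have ndg x : {homo (fun n => g n x) : n m / (n <= m)%N >-> n <= m}.
  by move=> n m nm; have /lefP := nd_nnsfun_approx measurableT mf' nm; exact.
exists (fun n x => g n x); split => //.
- move=> n; split; first exact: (@fimfunP _ _ (g n)).
  by move=> z; exact: (measurable_funPTI (g n)).
- move=> n x; rewrite fun_ge0/=.
  rewrite -(cvg_lim _ (gf x))//; apply: nondecreasing_cvgn_le => //.
  exact: cvgP (gf x).
Qed.

End simple_approximation.

(** Positive and negative parts are approximated from below. The bound by [|x|] provides the
    domination for exchanging limit and sum in [cvg_riesz_approx]. *)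
Lemma id_approx (R : realType) : exists q : nat -> R -> R,
  [/\ forall n, finitely_valued (q n), forall n x, `|q n x - x| <= `|x| &
      forall x, q n x @[n --> \oo] --> x].
Proof.
have mp : measurable_fun setT (fun x : R => Num.max x 0).
  exact: measurable_maxr.
have mn : measurable_fun setT (fun x : R => Num.max (- x) 0).
  by apply: measurable_maxr => //; exact: measurable_oppr.
have max_ge0 (x : R) : 0 <= Num.max x 0 by rewrite le_max lexx orbT.
have [g [sg gle gcvg]] := nnsfun_ge0_approx mp max_ge0.
have [h [sh hle hcvg]] := nnsfun_ge0_approx mn (fun x => max_ge0 (- x)).
(* At each point one of the two parts vanishes, and its approximation with it, being squeezed
   between 0 and that part. *)
exists (fun n x => g n x - h n x); split.
- by move=> n; exact: (finitely_valued_comp2 (fun a b => a - b)).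
- move=> n x; have /andP[g0 g1] := gle n x; have /andP[h0 h1] := hle n x.
  move: g1 h1; have [x0|x0] := leP 0 x.
    rewrite max_r ?oppr_le0// => g1 h1.
    rewrite ler_norml ger0_norm//; apply/andP; split; lra.
  rewrite max_l ?oppr_ge0 ?(ltW x0)// => g1 h1.
  rewrite ler_norml ltr0_norm//; apply/andP; split; lra.
- move=> x; suff mx : Num.max x 0 - Num.max (- x) 0 = x.
    rewrite -[X in _ --> X]mx; exact: cvgB (gcvg x) (hcvg x).
  have [x0|x0] := leP 0 x; first by rewrite max_r ?oppr_le0 ?subr0.
  by rewrite max_l ?oppr_ge0 ?(ltW x0)// sub0r opprK.
Qed.

(* Tannery's theorem. *)
Lemma cvg_sum_dominated (R : realType) (d : nat -> nat -> R) (x : nat -> R) :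
  (forall n j, 0 <= d n j <= x j) -> cvgn (series x) ->
  (forall j, d n j @[n --> \oo] --> 0) ->
  \sum_(j < n) d n j @[n --> \oo] --> 0.
Proof.
move=> dx cx d0.
have x0 j : 0 <= x j by have /andP[] := dx 0%N j; exact: le_trans.
apply/cvgrPdist_lt => e e0.
have e2 : 0 < e / 2 by rewrite divr_gt0.
have ndx : {homo series x : n m / (n <= m)%N >-> n <= m}.
  by apply/nondecreasing_seqP => n; rewrite seriesSr lerDl.
have /cvgrPdist_lt /(_ _ e2) [J _ HJ] := cx.
have xJ n : (J <= n)%N -> series x n - series x J < e / 2.
  move=> Jn; have := HJ J (leqnn J); have := nondecreasing_cvgn_le ndx cx n.
  move=> h /= /ltr_normlW; lra.
have dJ : \sum_(j < J) d n j @[n --> \oo] --> 0.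
  elim: J {HJ xJ} => [|J ih].
    by under eq_cvg do rewrite big_ord0; exact: cvg_cst.
  have -> : (fun n => \sum_(j < J.+1) d n j) =
      (fun n => \sum_(j < J) d n j) + d^~ J.
    by apply/funext => n; rewrite big_ord_recr.
  suff : ((fun n => \sum_(j < J) d n j) + d^~ J) @ \oo --> (0 + 0 : R).
    by rewrite addr0.
  by apply: cvgD; [exact: ih|exact: d0].
have /cvgrPdist_lt /(_ _ e2) HdJ := dJ.
near=> n; have Jn : (J <= n)%N by near: n; exists J.
rewrite sub0r normrN ger0_norm; last first.
  by apply: sumr_ge0 => j _; have /andP[] := dx n j.
rewrite (splitr e) -(big_mkord xpredT) (big_cat_nat (n := J))//= ltrD//.
  have : `|0 - \sum_(j < J) d n j| < e / 2 by near: n.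
  by rewrite sub0r normrN big_mkord; exact/le_lt_trans/ler_norm.
apply: le_lt_trans (xJ n Jn); rewrite sub_series_geq//.
by apply: ler_sum => j _; have /andP[] := dx n j.
Unshelve. all: by end_near. Qed.

(** * Nonnegative series and square summability *)

Section series_lemmas.
Context {R : realType}.

Lemma nneseries_fin_le (c : nat -> R) (s : R) : (forall j, 0 <= c j) ->
  (forall n, \sum_(j < n) c j <= s) -> (\sum_(j <oo) (c j)%:E <= s%:E)%E.
Proof.
move=> c0 cs; apply: lime_le.
  by apply: is_cvg_nneseries => j _ _; rewrite lee_fin.
by near=> n; rewrite sumEFin lee_fin big_mkord.
Unshelve. all: by end_near. Qed.

(** Since y^2 <= 4 exp(y^2/4), each b_j^2 y_j^2 is at most 4/k times the j-th term of the finite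
    series. *)
Lemma ell2_of_expR_series (b c y : nat -> R) (k : R) : 0 < k ->
  (forall j, k * b j ^+ 2 <= c j) ->
  (\sum_(j <oo) (c j * expR (y j ^+ 2 / 4))%:E < +oo)%E ->
  ell2 (fun j => b j * y j).
Proof.
move=> k0 kc cy; apply: nnseries_is_cvg => [j|]; first exact: sqr_ge0.
have c0 j : 0 <= c j.
  by apply: le_trans (kc j); rewrite mulr_ge0 ?sqr_ge0 ?ltW.
apply: (@le_lt_trans _ _
    (\sum_(j <oo) ((4 / k)%:E * (c j * expR (y j ^+ 2 / 4))%:E))%E).
  apply: lee_nneseries => j _; first by rewrite lee_fin sqr_ge0.
  rewrite -EFinM lee_fin exprMn.
  have y4 : y j ^+ 2 <= 4 * expR (y j ^+ 2 / 4).
    by have := expR_ge1Dx (y j ^+ 2 / 4); lra.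
  apply: (@le_trans _ _ (b j ^+ 2 * (4 * expR (y j ^+ 2 / 4)))).
    by rewrite ler_wpM2l ?sqr_ge0.
  have -> : 4 / k * (c j * expR (y j ^+ 2 / 4)) =
      (c j / k) * (4 * expR (y j ^+ 2 / 4)) by ring.
  rewrite ler_wpM2r ?mulr_ge0 ?expR_ge0//.
  by rewrite ler_pdivlMr// mulrC.
rewrite nneseriesZl; last by move=> j _; rewrite lee_fin mulr_ge0 ?expR_ge0.
have : (0 <= \sum_(j <oo) (c j * expR (y j ^+ 2 / 4))%:E)%E.
  by apply: nneseries_ge0 => j _ _; rewrite lee_fin mulr_ge0 ?expR_ge0.
case: (X in (X < +oo)%E) cy => //= r _ r0.
by rewrite -EFinM ltry.
Qed.

End series_lemmas.

(** * Almost sure square summability *)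

Section gaussian_ell2.
Context {R : realType} (gamma : probability (product_space R nat) R).
Hypothesis gammaP : standard_gaussian gamma.
Variables (b : nat -> R) (B : R).
Hypothesis bB : forall n, \sum_(j < n) b j ^+ 2 <= B.

(** The series of the b_j^2 exp(y_j^2/4) has integral at most B sqrt 2, hence is finite almost
    everywhere. *)
Lemma gaussian_ae_ell2 : {ae gamma, forall y, ell2 (fun j => b j * y j)}.
Proof.
pose h (y : product_space R nat) :=
  (\sum_(j <oo) (b j ^+ 2 * expR (y j ^+ 2 / 4))%:E)%E.
have h0 y : (0 <= h y)%E.
  by apply: nneseries_ge0 => j _ _; rewrite lee_fin mulr_ge0 ?sqr_ge0 ?expR_ge0.
have mh : measurable_fun setT h.
  apply: ge0_emeasurable_sum => [j y _ _|j _].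
    by rewrite lee_fin mulr_ge0 ?sqr_ge0 ?expR_ge0.
  apply/measurable_EFinP; apply: measurable_funM => //.
  exact: measurable_expR_coordinate.
have ih : gamma.-integrable setT h.
  apply/integrableP; split => //.
  under eq_integral do rewrite gee0_abs//.
  have := @integral_nneseries_expR_sqr4 _ gamma (fun j => b j ^+ 2) 0 B gammaP
    (fun j => sqr_ge0 _) (lexx _)
    (nneseries_fin_le (fun j => sqr_ge0 _) bB).
  rewrite (eq_integral h) => [|y _]; last exact: add0e.
  by move/le_lt_trans; apply; rewrite ltry.
apply: filterS (integrable_ae measurableT ih) => y /(_ I).
rewrite ge0_fin_numE// => hy.
apply: (@ell2_of_expR_series _ _ (fun j => b j ^+ 2) _ 1) => // j.
by rewrite mul1r.
Qed.

End gaussian_ell2.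

(** * Convergence of the Riesz expansion *)

Section riesz_expansion.
Context {R : realType} {X : hilbertType R}.
Variables (psi : nat -> X) (Cpsi : R).
Hypotheses (rp : riesz_basis psi Cpsi) (Cpsi0 : 0 < Cpsi).
Variables (b : nat -> R).

Lemma riesz_cvg (y : nat -> R) : ell2 (fun j => b j * y j) ->
  cvgn (series (fun j => (y j * b j) *: psi j)).
Proof.
move=> by2; have /rp[] // : ell2 (fun j => y j * b j).
by rewrite (_ : (fun j => y j * b j) = (fun j => b j * y j))//;
  apply/funext => j; rewrite mulrC.
Qed.

(** Truncation and approximation of the coordinates happen at once. By the Riesz inequality the
    squared distance to the exact partial sum is at most Cpsi^2 times the sum of the [d n j]; these
    are dominated by (b_j y_j)^2, so Tannery's theorem applies. *)
Lemma cvg_riesz_approx (q : nat -> R -> R) (y : nat -> R) :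
  (forall n x, `|q n x - x| <= `|x|) -> (forall x, q n x @[n --> \oo] --> x) ->
  ell2 (fun j => b j * y j) ->
  \sum_(j < n) (q n (y j) * b j) *: psi j @[n --> \oo] -->
  limn (series (fun j => (y j * b j) *: psi j)).
Proof.
move=> qle qcvg by2; pose d n j := (b j * (q n (y j) - y j)) ^+ 2.
have d0 : \sum_(j < n) d n j @[n --> \oo] --> 0.
  apply: (@cvg_sum_dominated _ d (fun j => (b j * y j) ^+ 2)) => //.
  - move=> n j; rewrite sqr_ge0/= /d !exprMn ler_wpM2l ?sqr_ge0//.
    rewrite -(real_normK (num_real (y j))) -real_normK ?num_real//.
    by rewrite lerXn2r ?nnegrE.
  - move=> j; rewrite (_ : 0 = (b j * (y j - y j)) ^+ 2); last first.
      by rewrite subrr mulr0 expr0n.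
    apply: (cvg_comp _ (fun x => x ^+ 2)); last exact: exprn_continuous.
    apply: cvgMr; apply: cvgB; [exact: qcvg|exact: cvg_cst].
set v := limn _; have vcvg : series (fun j => (y j * b j) *: psi j) @ \oo --> v.
  exact: riesz_cvg.
have ecvg : (fun n => \sum_(j < n) ((q n (y j) - y j) * b j) *: psi j) @ \oo -->
    (0 : X).
  apply/cvgrPdist_lt => e e0.
  have e1 : 0 < e ^+ 2 / Cpsi ^+ 2 by rewrite divr_gt0 ?exprn_gt0.
  have /cvgrPdist_lt /(_ _ e1) := d0.
  apply: filterS => n; rewrite !sub0r !normrN => dn.
  rewrite -ltr_sqr ?nnegrE ?(ltW e0)//.
  apply: (le_lt_trans (riesz_sum_le _ rp)).
  rewrite mulrC -ltr_pdivlMr ?exprn_gt0//; apply: le_lt_trans dn.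
  rewrite ger0_norm; last by apply: sumr_ge0 => j _; exact: sqr_ge0.
  rewrite le_eqVlt; apply/orP; left; apply/eqP/eq_bigr => j _.
  by rewrite /d mulrC.
rewrite -(addr0 v) (_ : (fun n => \sum_(j < n) (q n (y j) * b j) *: psi j) =
    series (fun j => (y j * b j) *: psi j) +
    (fun n => \sum_(j < n) ((q n (y j) - y j) * b j) *: psi j)).
  by apply: cvgD; [exact: vcvg|exact: ecvg].
apply/funext => n; rewrite /series /= fctE big_mkord -big_split/=.
by apply: eq_bigr => j _; rewrite -scalerDl; congr (_ *: _); ring.
Qed.

End riesz_expansion.

(** * Growth and increments of G along finite combinations *)

Section growth.
Context {R : realType} {X Y : hilbertType R}.
Variables (psi : nat -> X) (G : complexification X -> complexification Y).
Variables (b : nat -> R) (B Cpsi theta C alpha tau lam K : R).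
Hypotheses (rp : riesz_basis psi Cpsi) (Cpsi0 : 0 < Cpsi) (theta0 : 0 < theta).
Hypotheses (C0 : 0 < C) (alpha0 : 0 < alpha) (lam0 : 0 < lam).
Hypotheses (b0 : forall j, 0 < b j) (B0 : 0 < B).
Hypothesis bB : forall n, \sum_(j < n) b j ^+ 2 <= B.
Hypothesis tauK : forall x, 0 <= x -> x `^ tau <= lam * x ^+ 2 + K.
Hypothesis lamE : 4 * alpha * lam * Cpsi ^+ 2 = (8 * B)^-1.
Hypothesis G_le : forall a, strip theta a ->
  rnorm (G a) <= C * expR (alpha * rnorm a `^ tau).
Hypothesis G_lip : forall a a', strip theta a -> strip theta a' ->
  rnorm (G a - G a') <=
  C * expR (alpha * (rnorm a `^ tau + rnorm a' `^ tau)) * rnorm (a - a').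

Let comb N := @complex_comb R X N (fun j : 'I_N => b j *: psi j).

Lemma normc_sqr (z : R[i]) :
  rnorm z ^+ 2 = complex.Re z ^+ 2 + complex.Im z ^+ 2.
Proof. by rewrite /rnorm normc_def/= sqr_sqrtr// addr_ge0// sqr_ge0. Qed.

Lemma Re_realD (r : R) (z : R[i]) : complex.Re (r%:C%C + z) = r + complex.Re z.
Proof. by case: z. Qed.

Lemma Im_realD (r : R) (z : R[i]) : complex.Im (r%:C%C + z) = complex.Im z.
Proof. by case: z => p q /=; rewrite add0r. Qed.

Lemma cpolydisc_cstrip N (rho : 'I_N -> R) (z : 'rV[R[i]]_N) (y : 'I_N -> R) :
  cpolydisc rho z -> cstrip rho (real_point y + z).
Proof.
move=> zrho j; rewrite !mxE Im_realD; apply: le_lt_trans (zrho j).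
rewrite -ler_sqr ?nnegrE ?rnorm_ge0// normc_sqr real_normK ?num_real//.
by rewrite lerDr sqr_ge0.
Qed.

Lemma riesz_scaled_le N (x : 'I_N -> R) :
  `|\sum_(j < N) x j *: (b j *: psi j)| ^+ 2 <=
  Cpsi ^+ 2 * \sum_(j < N) b j ^+ 2 * x j ^+ 2.
Proof.
have := riesz_sum_le (fun j : 'I_N => b j * x j) rp.
under eq_bigr do rewrite mulrC -scalerA.
by under [X in _ <= _ * X]eq_bigr do rewrite exprMn.
Qed.

(** The squared imaginary part is at most Cpsi^2 times the sum of b_j^2 (Im z_j)^2, which
    admissibility keeps below (theta/Cpsi)^2. *)
Lemma comb_strip N (rho : 'I_N -> R) (z : 'rV[R[i]]_N) : (0 < N)%N ->
  admissible b (theta / Cpsi) rho -> cstrip rho z -> strip theta (comb z).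
Proof.
move=> N0 [rho0 rhole] zrho; rewrite /strip/= complex_comb2.
rewrite -ltr_sqr ?nnegrE ?(ltW theta0)//.
apply: (le_lt_trans (riesz_scaled_le _)).
rewrite mulrC -ltr_pdivlMr ?exprn_gt0// -expr_div_n; apply: lt_le_trans rhole.
(* The termwise strict inequality passes to the sum only if there is a term, whence [0 < N]. *)
apply: ltr_sum => [|j _].
  case: N N0 rho rho0 z zrho => // N _ *.
  by apply/hasP; exists ord0; rewrite ?mem_index_enum.
rewrite ltr_pM2l ?exprn_gt0// -(real_normK (num_real (complex.Im (z 0 j)))).
by rewrite ltr_sqr ?nnegrE ?(ltW (rho0 j)).
Qed.

Lemma holomorphic_comb N (rho : 'I_N -> R) : (0 < N)%N ->
  admissible b (theta / Cpsi) rho -> holomorphic_on (strip theta) G ->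
  holomorphic_on (cstrip rho) (fun z => G (comb z)).
Proof.
move=> N0 adm hG z zrho; apply: differentiable_comp.
  exact: differentiable_complex_comb.
exact/hG/(comb_strip N0 adm).
Qed.

Lemma G_growth a : strip theta a ->
  rnorm (G a) <= C * expR (alpha * (lam * rnorm a ^+ 2 + K)).
Proof.
move=> /G_le/le_trans; apply; rewrite ler_wpM2l ?(ltW C0)// ler_expR.
by rewrite ler_wpM2l ?(ltW alpha0)// tauK// rnorm_ge0.
Qed.

(** The function phi_N of condition (2); neither the radii nor the complex shift enter it. *)
Definition holomorphy_bound N (y : 'I_N -> R) : R :=
  C * expR (alpha * (lam * (2 * Cpsi ^+ 2 *
    (\sum_(j < N) b j ^+ 2 * y j ^+ 2 + (theta / Cpsi) ^+ 2)) + K)).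

(** With z_j = p + iq and p^2 + q^2 <= rho_j^2, one has (y_j + p)^2 + q^2 <= 2 (y_j^2 + rho_j^2);
    admissibility then bounds the weighted sum of the rho_j^2. *)
Lemma G_comb_le N (rho : 'I_N -> R) (z : 'rV[R[i]]_N) (y : 'I_N -> R) :
  (0 < N)%N -> admissible b (theta / Cpsi) rho -> cpolydisc rho z ->
  rnorm (G (comb (real_point y + z))) <= holomorphy_bound y.
Proof.
move=> N0 adm zrho; set a := comb _.
have sa : strip theta a by apply: (comb_strip N0 adm); exact: cpolydisc_cstrip.
apply: (le_trans (G_growth sa)); rewrite /holomorphy_bound.
rewrite ler_wpM2l ?(ltW C0)// ler_expR ler_wpM2l ?(ltW alpha0)// lerD2r.
rewrite ler_wpM2l ?(ltW lam0)// sqr_rnorm.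
rewrite [a.1]complex_comb1 [a.2]complex_comb2.
apply: (le_trans (lerD (riesz_scaled_le _) (riesz_scaled_le _))).
rewrite -mulrDr -big_split/= -mulrA mulrCA ler_wpM2l ?sqr_ge0//.
case: adm => rho0 /(lerD (lexx (\sum_(j < N) b j ^+ 2 * y j ^+ 2))) h.
apply: le_trans (_ : 2 * (\sum_(j < N) b j ^+ 2 * y j ^+ 2 +
  \sum_(j < N) b j ^+ 2 * rho j ^+ 2) <= _); last by rewrite ler_wpM2l.
rewrite -big_split/= mulr_sumr; apply: ler_sum => j _.
rewrite !mxE Re_realD Im_realD -!mulrDr mulrCA ler_wpM2l ?sqr_ge0//.
have zj : rnorm (z 0 j) ^+ 2 <= rho j ^+ 2.
  by rewrite lerXn2r ?nnegrE ?rnorm_ge0 ?(ltW (rho0 j))// ltW.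
move: zj; rewrite normc_sqr.
have := sqr_ge0 (y j - complex.Re (z 0 j)).
have := sqr_ge0 (complex.Im (z 0 j)).
rewrite sqrrB sqrrD; lra.
Qed.

(** The factor free of y in the squared bound, which equals this constant times exp(S(y) / (8
    B)). *)
Definition holomorphy_const : R :=
  C ^+ 2 * expR (2 * alpha * K + (theta / Cpsi) ^+ 2 / (8 * B)).
Local Notation P := holomorphy_const.

(** Jensen's inequality with weights b_j^2 / (2 B), for which S / (8 B) is the weighted sum of the
    y_j^2/4. *)
Lemma sqr_holomorphy_bound_le N (y : 'I_N -> R) :
  holomorphy_bound y ^+ 2 <=
  P + \sum_(j < N) P * b j ^+ 2 / (2 * B) * expR (y j ^+ 2 / 4).
Proof.
pose S := \sum_(j < N) b j ^+ 2 * y j ^+ 2.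
have -> : holomorphy_bound y ^+ 2 = P * expR (S / (8 * B)).
  rewrite /holomorphy_bound -/S exprMn /holomorphy_const -[RHS]mulrA.
  congr (_ * _).
  rewrite [LHS]expr2 -!expRD; congr expR.
  transitivity (4 * alpha * lam * Cpsi ^+ 2 * (S + (theta / Cpsi) ^+ 2) +
      2 * alpha * K).
    by ring.
  by rewrite lamE; ring.
have P0 : 0 <= P by rewrite mulr_ge0 ?expR_ge0 ?sqr_ge0.
have -> : P + \sum_(j < N) P * b j ^+ 2 / (2 * B) * expR (y j ^+ 2 / 4) =
    P * (1 + \sum_(j < N) b j ^+ 2 / (2 * B) * expR (y j ^+ 2 / 4)).
  by rewrite mulrDr mulr1 mulr_sumr; congr (_ + _); apply: eq_bigr => j _; ring.
rewrite ler_wpM2l//.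
have -> : S / (8 * B) = \sum_(j < N) b j ^+ 2 / (2 * B) * (y j ^+ 2 / 4).
  rewrite mulr_suml; apply: eq_bigr => j _; field; exact: lt0r_neq0.
apply: expR_sum_le => [j|].
  by rewrite divr_ge0 ?sqr_ge0// mulr_ge0// ltW.
rewrite -mulr_suml ler_pdivrMr ?mulr_gt0// mul1r.
by apply: le_trans (bB N) _; rewrite ler_peMl ?(ltW B0)// ler1n.
Qed.

Let pcomb (y : nat -> R) N := \sum_(j < N) (y j * b j) *: psi j.

Lemma strip_of_real (x : X) : strip theta (of_real x).
Proof. by rewrite /strip/= normr0. Qed.

Lemma sqr_norm_pcomb_le (y : nat -> R) N :
  `|pcomb y N| ^+ 2 <= Cpsi ^+ 2 * \sum_(j < N) b j ^+ 2 * y j ^+ 2.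
Proof.
have := riesz_scaled_le (fun j : 'I_N => y j).
by under eq_bigr do rewrite scalerA.
Qed.

(** Collects the factors free of y in the squared Lipschitz bound, including the Cpsi^2 of the tail
    estimate. *)
Definition increment_const : R := (C * Cpsi) ^+ 2 * expR (4 * alpha * K).
Local Notation Q := increment_const.

(** Both partial sums have squared norm at most Cpsi^2 S, and their difference at most Cpsi^2 T,
    with T the tail sum. The squared Lipschitz bound is thus at most Q exp(S / (8 B)) T, the product
    handled by [expR_mul_tail_le]. *)
Lemma sqr_G_pcomb_diff_le (y : nat -> R) N M (t : R) : (N <= M)%N ->
  \sum_(j < M | (N <= j)%N) b j ^+ 2 <= t ->
  rnorm (G (of_real (pcomb y M)) - G (of_real (pcomb y N))) ^+ 2 <=
  Q * (t + \sum_(j < M) (32 * (if (N <= j)%N then b j ^+ 2 else 0) +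
                    t / B * b j ^+ 2) * expR (y j ^+ 2 / 4)).
Proof.
move=> NM bt; have Q0 : 0 <= Q by rewrite mulr_ge0 ?sqr_ge0 ?expR_ge0.
apply: le_trans (ler_wpM2l Q0 (expR_mul_tail_le y B0 (bB M) bt)).
set S := \sum_(j < M) _; set T := \sum_(j < M | _) _.
have SN : \sum_(j < N) b j ^+ 2 * y j ^+ 2 <= S.
  rewrite /S (big_ord_widen M (fun j => b j ^+ 2 * y j ^+ 2) NM) big_mkcond/=.
  by apply: ler_sum => j _; case: ifP => // _; rewrite mulr_ge0 ?sqr_ge0.
have tauS N' : \sum_(j < N') b j ^+ 2 * y j ^+ 2 <= S ->
    rnorm (of_real (pcomb y N')) `^ tau <= lam * (Cpsi ^+ 2 * S) + K.
  move=> h; rewrite rnorm_of_real; apply: (le_trans (tauK (normr_ge0 _))).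
  rewrite lerD2r ler_wpM2l ?(ltW lam0)//.
  apply: (le_trans (sqr_norm_pcomb_le _ _)).
  by rewrite ler_wpM2l ?sqr_ge0.
have d0 : `|pcomb y M - pcomb y N| ^+ 2 <= Cpsi ^+ 2 * T.
  have := riesz_tail_sum_le (fun j => y j * b j) rp NM.
  by under [X in _ <= _ * X]eq_bigr do rewrite exprMn mulrC.
have := G_lip (strip_of_real (pcomb y M)) (strip_of_real (pcomb y N)).
rewrite -of_realB [rnorm (of_real (_ - _))]rnorm_of_real => h.
have {}h : rnorm (G (of_real (pcomb y M)) - G (of_real (pcomb y N))) <=
    C * expR (alpha * (2 * (lam * (Cpsi ^+ 2 * S) + K))) *
    `|pcomb y M - pcomb y N|.
  apply: (le_trans h); rewrite ler_wpM2r// ler_wpM2l ?(ltW C0)// ler_expR.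
  rewrite ler_wpM2l ?(ltW alpha0)// mulr_natl mulr2n lerD// tauS//.
apply: (@le_trans _ _
    ((C * expR (alpha * (2 * (lam * (Cpsi ^+ 2 * S) + K)))) ^+ 2 *
     (Cpsi ^+ 2 * T))).
  apply: (@le_trans _ _ ((C * expR (alpha * (2 * (lam * (Cpsi ^+ 2 * S) + K))) *
      `|pcomb y M - pcomb y N|) ^+ 2)).
    rewrite lerXn2r ?nnegrE ?rnorm_ge0//.
    by rewrite !mulr_ge0 ?expR_ge0 ?(ltW C0).
  by rewrite exprMn ler_wpM2l ?sqr_ge0.
rewrite le_eqVlt; apply/orP; left; apply/eqP.
have -> : (C * expR (alpha * (2 * (lam * (Cpsi ^+ 2 * S) + K)))) ^+ 2 =
    C ^+ 2 * expR (4 * alpha * K) * expR (S / (8 * B)).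
  rewrite exprMn -[RHS]mulrA; congr (_ * _).
  rewrite [LHS]expr2 -!expRD; congr expR.
  by rewrite -lamE; ring.
by rewrite /increment_const exprMn; ring.
Qed.

End growth.

(** * Measurability and L^2 estimates for the parametric map *)

Section parametric_map.
Context {R : realType} {X Y : hilbertType R}.
Variables (psi : nat -> X) (G : complexification X -> complexification Y).
Variables (b : nat -> R) (Cpsi theta : R).
Hypotheses (rp : riesz_basis psi Cpsi) (Cpsi0 : 0 < Cpsi) (theta0 : 0 < theta).
Hypothesis hG : holomorphic_on (strip theta) G.

Lemma cvg_G_of_real (f : nat -> X) (v : X) : f n @[n --> \oo] --> v ->
  G (of_real (f n)) @[n --> \oo] --> G (of_real v).
Proof.
move=> fv.
have fv' : of_real (f n) @[n --> \oo] --> of_real v by exact: cvg_of_real.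
apply: (cvg_comp _ _ fv').
exact: differentiable_continuous (hG (strip_of_real theta0 v)).
Qed.

(** The n-th simple function feeds G with n finitely valued coordinates, so it has finitely many
    values; continuity of G gives convergence wherever y is square summable with weights b. *)
Lemma strongly_measurable_param_map
    (gamma : probability (product_space R nat) R) (B : R) :
  standard_gaussian gamma -> (forall n, \sum_(j < n) b j ^+ 2 <= B) ->
  strongly_measurable gamma (param_map G b psi).
Proof.
move=> gammaP bB; have [q [sq qle qcvg]] := id_approx R.
exists (fun n y => G (of_real (\sum_(j < n) (q n (y j) * b j) *: psi j))).
split=> [n|].
  apply: (finitely_valued_comp (fun v => G (of_real v))).
  apply: (@finitely_valued_sum _ _ _ n (fun j (y : product_space R nat) =>
    (q n (y j) * b j) *: psi j)) => j.
  apply: (finitely_valued_comp (fun a => (a * b j) *: psi j)).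
  exact: finitely_valued_coordinate.
have := gaussian_ae_ell2 gammaP bB; apply: negligibleS; apply: subsetC => y by2.
rewrite /mkset /param_map asboolT//; apply: cvg_G_of_real.
exact: (cvg_riesz_approx rp Cpsi0 qle qcvg by2).
Qed.

Variables (B C alpha tau lam K : R).
Hypotheses (C0 : 0 < C) (alpha0 : 0 < alpha) (lam0 : 0 < lam).
Hypotheses (b0 : forall j, 0 < b j) (B0 : 0 < B).
Hypothesis bB : forall n, \sum_(j < n) b j ^+ 2 <= B.
Hypothesis tauK : forall x, 0 <= x -> x `^ tau <= lam * x ^+ 2 + K.
Hypothesis lamE : 4 * alpha * lam * Cpsi ^+ 2 = (8 * B)^-1.
Hypothesis G_lip : forall a a', strip theta a -> strip theta a' ->
  rnorm (G a - G a') <=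
  C * expR (alpha * (rnorm a `^ tau + rnorm a' `^ tau)) * rnorm (a - a').

Local Notation Q := (increment_const Cpsi C alpha K).

Let Q0 : 0 < Q.
Proof. by rewrite mulr_gt0 ?expR_gt0// exprn_gt0// mulr_gt0. Qed.

(** Here B is only an upper bound of the partial sums, so this dominates the tail sum, with equality
    when B is the full sum. *)
Let tail N := B - \sum_(j < N) b j ^+ 2.

Let weight N j :=
  Q * (32 * (if (N <= j)%N then b j ^+ 2 else 0) + tail N / B * b j ^+ 2).

(** Strict because b_N > 0; the multiple of b_j^2 in [weight] is then positive for every j,
    including j < N. *)
Let tail_gt0 N : 0 < tail N.
Proof.
rewrite subr_gt0; apply: lt_le_trans (bB N.+1).
by rewrite big_ord_recr/= ltrDl exprn_gt0.
Qed.

Let tailP N M : \sum_(j < M | (N <= j)%N) b j ^+ 2 <= tail N.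
Proof.
rewrite lerBrDl; have [NM|MN] := leqP N M.
  apply: le_trans (bB M).
  rewrite (big_ord_widen M (fun j => b j ^+ 2) NM).
  rewrite [leRHS](bigID (fun j : 'I_M => (j < N)%N))/=.
  by rewrite lerD2l; under [leRHS]eq_bigl do rewrite -leqNgt.
rewrite [X in _ + X]big1 ?addr0// => j Nj.
by have := ltn_trans (ltn_ord j) MN; rewrite ltnNge Nj.
Qed.

Let weight_ge0 N j : 0 <= weight N j.
Proof.
apply: mulr_ge0; first exact: ltW.
have tB : 0 <= tail N / B by rewrite divr_ge0 ?ltW.
apply: addr_ge0; last by rewrite mulr_ge0 ?sqr_ge0.
by apply: mulr_ge0 => //; case: ifP => // _; exact: sqr_ge0.
Qed.

(** The indicator part contributes 32 tails and the part proportional to b_j^2 / B one more. *)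
Let sum_weight N n : \sum_(j < n) weight N j <= 33 * Q * tail N.
Proof.
rewrite -mulr_sumr big_split/= -!mulr_sumr -big_mkcond/=.
have h1 := tailP N n.
have h2 : tail N / B * \sum_(j < n) b j ^+ 2 <= tail N.
  by rewrite -mulrA ler_piMr ?(ltW (tail_gt0 N))// mulrC ler_pdivrMr// mul1r.
have -> : 33 * Q * tail N = Q * (33 * tail N) by ring.
rewrite ler_wpM2l ?(ltW Q0)//; lra.
Qed.

(** The limit of [sqr_G_pcomb_diff_le] as M grows, by continuity of G. It holds at every y, as
    [Lnorm2_le_sqrt] demands. *)
Lemma sqr_param_map_diff_le N (y : nat -> R) :
  (((rnorm (param_map G b psi y -
            G (of_real (\sum_(j < N) (y j * b j) *: psi j)))) ^+ 2)%:E <=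
   (Q * tail N)%:E + \sum_(j <oo) (weight N j * expR (y j ^+ 2 / 4))%:E)%E.
Proof.
set h := (\sum_(j <oo) _)%E.
have h0 j : (0 <= (weight N j * expR (y j ^+ 2 / 4))%:E)%E.
  by rewrite lee_fin mulr_ge0 ?expR_ge0.
(* Where the series diverges the bound is trivial; where it converges, y is square summable with
   weights b and [param_map] does not take its default value 0. *)
have [hoo|] := ltP h +oo%E; last first.
  by rewrite leye_eq => /eqP ->; rewrite addey// leey.
have by2 : ell2 (fun j => b j * y j).
  apply: (ell2_of_expR_series _ _ hoo) => [|j].
    by apply: (_ : 0 < Q * (tail N / B)); rewrite mulr_gt0// divr_gt0.
  rewrite -mulrA ler_wpM2l ?(ltW Q0)// lerDr mulr_ge0//.
  by case: ifP => // _; exact: sqr_ge0.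
rewrite /param_map asboolT//.
have hfin : h \is a fin_num by rewrite ge0_fin_numE// nneseries_ge0.
rewrite -(fineK hfin) -EFinD lee_fin.
set r := _ + fine h; set w := G (of_real (\sum_(j < N) _)).
have r0 : 0 <= r.
  apply: addr_ge0; first by rewrite mulr_ge0// ltW.
  by apply: fine_ge0; exact: nneseries_ge0.
rewrite -[leRHS]sqr_sqrtr// lerXn2r ?nnegrE ?rnorm_ge0 ?sqrtr_ge0//.
have cvgG := cvg_G_of_real (riesz_cvg rp by2).
apply: (@cvg_rnorm_le _ _
    (fun n => G (of_real (\sum_(0 <= j < n) (y j * b j) *: psi j)) - w)).
  by apply: cvgB; [exact: cvgG|exact: cvg_cst].
exists N => // M /= NM.
rewrite -ler_sqr ?nnegrE ?rnorm_ge0 ?sqrtr_ge0// (sqr_sqrtr r0) big_mkord.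
have := sqr_G_pcomb_diff_le rp theta0 C0 alpha0 lam0 B0 bB tauK lamE G_lip y
  NM (tailP N M).
move=> /le_trans; apply.
rewrite mulrDr lerD2l -lee_fin fineK//.
apply: le_trans (nneseries_lim_ge M (fun j _ _ => h0 j)).
rewrite sumEFin lee_fin big_mkord mulr_sumr.
rewrite le_eqVlt; apply/orP; left; apply/eqP.
by apply: eq_bigr => j _; rewrite mulrA.
Qed.

Variable gamma : probability (product_space R nat) R.
Hypothesis gammaP : standard_gaussian gamma.

Lemma L2norm_param_map_diff_le N :
  (L2norm gamma (fun y => (param_map G b psi y -
     G (of_real (\sum_(j < N) (y j * b j) *: psi j)))%R) <=
   (Num.sqrt ((Q + 33 * Q * Num.sqrt 2) * tail N))%:E)%E.
Proof.
apply: (@Lnorm2_le_sqrt _ (product_space R nat) _ gamma _ (fun y =>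
  (Q * tail N)%:E + \sum_(j <oo) (weight N j * expR (y j ^+ 2 / 4))%:E)%E).
  exact: sqr_param_map_diff_le.
apply: (le_trans (integral_nneseries_expR_sqr4 gammaP (weight_ge0 N) _
  (nneseries_fin_le (weight_ge0 N) (sum_weight N)))).
  by rewrite mulr_ge0 ?(ltW Q0) ?(ltW (tail_gt0 N)).
by rewrite lee_fin le_eqVlt; apply/orP; left; apply/eqP; ring.
Qed.

(** The difference estimate at N = 0 compares u with the constant w = G(0), and |u|^2 <= 2 |u - w|^2
    + 2 |w|^2. *)
Lemma L2norm_param_map_lty : (L2norm gamma (param_map G b psi) < +oo)%E.
Proof.
pose w := G (of_real 0); pose c j := 2 * weight 0 j.
have c0 j : 0 <= c j by rewrite mulr_ge0.
have Qt0 : 0 <= Q * tail 0 by rewrite mulr_ge0// ltW.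
apply: (@le_lt_trans _ _ (Num.sqrt ((2 * (Q * tail 0) + 2 * rnorm w ^+ 2) +
    (2 * (33 * Q * tail 0)) * Num.sqrt 2))%:E); last by rewrite ltry.
apply: (@Lnorm2_le_sqrt _ _ _ gamma _ (fun y : product_space R nat =>
  ((2 * (Q * tail 0) + 2 * rnorm w ^+ 2)%:E +
   \sum_(j <oo) (c j * expR (y j ^+ 2 / 4))%:E)%E)) => [y|].
  have := sqr_param_map_diff_le 0 y; rewrite big_ord0 -/w => h.
  under eq_eseriesr do rewrite /c -mulrA EFinM.
  rewrite nneseriesZl; last by move=> j _; rewrite lee_fin mulr_ge0 ?expR_ge0.
  rewrite EFinD -addeA addeC -addeA [(_ * _)%:E in X in (_ + X)%E]EFinM.
  rewrite -ge0_muleDr; last 2 first.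
  - by apply: nneseries_ge0 => j _ _; rewrite lee_fin mulr_ge0 ?expR_ge0.
  - by rewrite lee_fin.
  rewrite [X in (_ * X)%E]addeC.
  apply: (le_trans _ (leeD2l _ (lee_wpmul2l _ h))); last by rewrite lee_fin.
  rewrite -EFinM -EFinD lee_fin.
  have := ler_rnormD (param_map G b psi y - w) w; rewrite subrK => h'.
  have : rnorm (param_map G b psi y) ^+ 2 <=
      (rnorm (param_map G b psi y - w) + rnorm w) ^+ 2.
    by rewrite lerXn2r ?nnegrE ?addr_ge0 ?rnorm_ge0.
  have := sqr_ge0 (rnorm (param_map G b psi y - w) - rnorm w).
  by rewrite sqrrB sqrrD; lra.
apply: (integral_nneseries_expR_sqr4 gammaP c0).
  by rewrite addr_ge0// mulr_ge0 ?sqr_ge0.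
apply: (nneseries_fin_le c0) => n.
by rewrite -mulr_sumr ler_wpM2l.
Qed.

End parametric_map.

(** * Verification of the holomorphy conditions *)

Theorem proposition5p2 (R : realType)
    (gammaN : forall N, probability (product_space R 'I_N) R)
    (gammaNP : forall N, standard_gaussian (gammaN N))
    (gamma : probability (product_space R nat) R)
    (gammaP : standard_gaussian gamma)
    (b : nat -> R) (b_gt0 : forall j, 0 < b j) (b_ell2 : ell2 b)
    (Cpsi theta C alpha tau Ctau : R)
    (Cpsi_ge1 : 1 <= Cpsi) (theta_gt0 : 0 < theta)
    (C_gt0 : 0 < C) (alpha_gt0 : 0 < alpha) (tau_ge0 : 0 <= tau) (tau_lt2 : tau < 2)
    (CtauP : forall x y : R, 0 <= x -> 0 <= y ->
       (x + y) `^ (tau / 2) <= Ctau * (x `^ (tau / 2) + y `^ (tau / 2))) :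
  exists2 delta : R, 0 < delta &
    forall (X Y : hilbertType R) (psi : nat -> X)
      (G : complexification X -> complexification Y),
    separable_space X -> separable_space Y ->
    riesz_basis psi Cpsi ->
    holomorphic_on (strip theta) G ->
    (forall a, strip theta a -> rnorm (G a) <= C * expR (alpha * rnorm a `^ tau)) ->
    (forall a a', strip theta a -> strip theta a' ->
       rnorm (G a - G a') <=
       C * expR (alpha * (rnorm a `^ tau + rnorm a' `^ tau)) * rnorm (a - a')) ->
    gaussian_holomorphic gammaN gamma b (theta / Cpsi) delta (param_map G b psi).
Proof.
pose B := ell2_sqnorm b.
have bnd : {homo series (fun j => b j ^+ 2) : n m / (n <= m)%N >-> n <= m}.
  by apply/nondecreasing_seqP => n; rewrite seriesSr lerDl sqr_ge0.
have bB n : \sum_(j < n) b j ^+ 2 <= B.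
  by have := nondecreasing_cvgn_le bnd b_ell2 n; rewrite /series/= big_mkord.
have B0 : 0 < B.
  apply: lt_le_trans (bB 1%N); rewrite big_ord_recr big_ord0/= add0r.
  by rewrite exprn_gt0.
have Cpsi0 : 0 < Cpsi by exact: lt_le_trans Cpsi_ge1.
(* In the exponent of either squared bound, S has coefficient 4 alpha lam Cpsi^2: one factor 2 comes
   from squaring, the other from the shift by z or from the two arguments of the Lipschitz bound.
   This choice makes it 1 / (8 B). *)
pose lam := (32 * alpha * Cpsi ^+ 2 * B)^-1.
have lam0 : 0 < lam by rewrite invr_gt0 !mulr_gt0 ?exprn_gt0.
have lamE : 4 * alpha * lam * Cpsi ^+ 2 = (8 * B)^-1.
  by rewrite /lam; field; rewrite !lt0r_neq0.
have [K K0 tauK] := powR_le_sqr tau_ge0 tau_lt2 lam0.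
pose P := holomorphy_const B Cpsi theta C alpha K.
have P0 : 0 < P by rewrite mulr_gt0 ?expR_gt0// exprn_gt0.
(* The integral of the majorant of phi_N^2 is P plus sqrt 2 times its weights, whose sum is at most
   P. The value is fixed before the spaces, [psi] and [G]. *)
exists (Num.sqrt (P + P * Num.sqrt 2)).
  by rewrite sqrtr_gt0 ltr_wpDr// mulr_ge0 ?sqrtr_ge0 ?(ltW P0).
move=> X Y psi G _ _ rp hG G_le G_lip; split.
  split.
    exact: (strongly_measurable_param_map rp Cpsi0 theta_gt0 hG gammaP bB).
  exact: (L2norm_param_map_lty rp Cpsi0 theta_gt0 hG C_gt0 alpha_gt0 lam0 b_gt0
    B0 bB tauK lamE G_lip gammaP).
exists (fun N (y : 'I_N -> R) => G (of_real (\sum_j y j *: (b j *: psi j)))).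
(* One formula, independent of [rho], serves all admissible strips. *)
exists (fun N rho z => G (complex_comb (fun j : 'I_N => b j *: psi j) z)).
split.
- move=> N rho N0 adm; split; last by move=> y; rewrite complex_comb_real.
  exact: (holomorphic_comb rp Cpsi0 theta_gt0 b_gt0 N0 adm hG).
- move=> N M y /andP[_ NM]; congr (G (of_real _)).
  (* Below M, padding by zero agrees with [extend0], whose terms vanish from N on. *)
  pose g k := extend0 y k *: (b k *: psi k).
  have g0 k : (N <= k)%N -> g k = 0.
    by move=> Nk; rewrite /g extend0_out// scale0r.
  transitivity (\sum_(k < N) g k).
    by apply: eq_bigr => j _; rewrite /g extend0_ord.
  by rewrite -(sum_vanishing_tail g0 (ltnW NM)) big_mkord.
- move=> N N0.
  exists (fun y : product_space R 'I_N =>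
    holomorphy_bound b Cpsi theta C alpha lam K y).
  split.
  + apply: measurable_funM => //; apply: measurableT_comp => //.
    apply: measurable_funM => //; apply: measurable_funD => //.
    apply: measurable_funM => //; apply: measurable_funM => //.
    apply: measurable_funD => //; apply: measurable_sum => j.
    apply: measurable_funM => //; apply: measurable_funX.
    exact: measurable_coordinate.
  + by move=> y; rewrite mulr_ge0 ?expR_ge0 ?(ltW C_gt0).
  + pose c (j : 'I_N) := P * b j ^+ 2 / (2 * B).
    have c0 j : 0 <= c j.
      apply: divr_ge0; apply: mulr_ge0; [exact: ltW|exact: sqr_ge0|by []|].
      exact: ltW.
    apply: (@Lnorm2_le_sqrt _ (product_space R 'I_N) _ _ _ (fun y =>
      (P + \sum_j c j * expR (y j ^+ 2 / 4))%:E)) => [y|].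
      by rewrite lee_fin; exact: sqr_holomorphy_bound_le.
    rewrite (integral_sum_expR_sqr4 (gammaNP N) c0 (ltW P0)) lee_fin lerD2l.
    rewrite ler_wpM2r ?sqrtr_ge0// -mulr_suml -mulr_sumr.
    rewrite ler_pdivrMr ?mulr_gt0//.
    rewrite ler_wpM2l ?(ltW P0)//; apply: le_trans (bB N) _.
    by rewrite ler_peMl ?(ltW B0)// ler1n.
  + move=> rho z y adm zrho.
    exact: (G_comb_le rp Cpsi0 theta_gt0 C_gt0 alpha_gt0 lam0 b_gt0 tauK G_le
      y N0 adm zrho).
- pose kappa := increment_const Cpsi C alpha K.
  pose t N := Num.sqrt
    ((kappa + 33 * kappa * Num.sqrt 2) * (B - \sum_(j < N) b j ^+ 2)).
  (* B is the full sum of the b_j^2, so its distance to the partial sums tends to 0. *)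
  have t0 : t N @[N --> \oo] --> 0.
    have h : (kappa + 33 * kappa * Num.sqrt 2) * (B - \sum_(j < N) b j ^+ 2)
        @[N --> \oo] --> (kappa + 33 * kappa * Num.sqrt 2) * (B - B).
      apply: cvgMr; apply: cvgB; first exact: cvg_cst.
      rewrite (_ : (fun N => _) = series (fun j => b j ^+ 2))//.
      by apply/funext => N; rewrite /series/= big_mkord.
    rewrite subrr mulr0 in h.
    rewrite -sqrtr0; apply: (cvg_comp _ _ h); exact: sqrt_continuous.
  apply: (@squeeze_cvge _ _ _ _ (cst 0%E) _ (fun N => (t N)%:E)).
  + near=> N; rewrite Lnorm_ge0/=.
    have := L2norm_param_map_diff_le rp Cpsi0 theta_gt0 hG C_gt0 alpha_gt0 lam0
      b_gt0 B0 bB tauK lamE G_lip gammaP N.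
    congr (L2norm _ _ <= _)%E; apply/funext => y; congr (_ - G (of_real _)).
    by apply: eq_bigr => j _; rewrite scalerA.
  + exact: cvg_cst.
  + by apply/fine_cvgP; split; [exact: nearW|exact: t0].
Unshelve. all: by end_near.
Qed.
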